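(* Let $P\geq1$. For $i=1,\dots,P$ let $r_i\in\mathbb{R}$, let $\Phi_i:\mathbb{R}^d\to\mathbb{C}$ be a $\mathcal{C}^\infty$ function such that for all $\alpha\in\mathbb{N}^d$ there is a constant $c_{i,\alpha}$ with $|\partial_x^\alpha\Phi_i(x)|\leq c_{i,\alpha}\langle x\rangle^{r_i-|\alpha|}$ for all $x\in\mathbb{R}^d$, and let $V_i:\mathbb{T}^d\to\mathbb{C}$ be a smooth function. Then $$A=\prod_{i=1}^PA_{\Phi_i}B_{V_i}\in\mathcal{A}_r,\quad\text{with}\quad r=r_1+\cdots+r_P.$$
   Context: $d\geq1$ is a fixed integer, $\mathbb{N}=\{0,1,\dots\}$, $\mathbb{T}^d=(\mathbb{R}/2\pi\mathbb{Z})^d$, $\langle x\rangle=(1+|x|^2)^{1/2}$, and $|k|=|k_1|+\cdots+|k_d|$ for $k\in\mathbb{Z}^d$ and for multi-indices. $A_\Phi$ is the infinite diagonal matrix $A_\Phi(m,n)=\Phi(m)\delta_{mn}$, and $B_V(m,n)=\hat V(m-n)$, $m,n\in\mathbb{Z}^d$, where $\hat V(k)=(2\pi)^{-d}\int_{\mathbb{T}^d}e^{-ik\cdot x}V(x)\,\mathrm{d}x$. The product of infinite matrices is $(AB)(m,n)=\sum_{k\in\mathbb{Z}^d}A(m,k)B(k,n)$. For an infinite matrix $A:\mathbb{Z}^d\times\mathbb{Z}^d\to\mathbb{C}$, with $e_j$ the $j$-th basis vector, $(\Delta_j^\pm A)(m,n)=A(m\pm e_j,n\pm e_j)-A(m,n)$;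 for $a\in\mathbb{Z}$, $\Delta_j^a=(\Delta_j^+)^a$ if $a\geq0$ and $(\Delta_j^-)^{|a|}$ if $a\leq0$; $\Delta^\alpha=\Delta_1^{\alpha_1}\cdots\Delta_d^{\alpha_d}$ for $\alpha\in\mathbb{Z}^d$. $A\in\mathcal{A}_r$ means: for all $\alpha\in\mathbb{Z}^d$ and $N\in\mathbb{N}$ there is $C_{N,\alpha}\geq0$ with $|(\Delta^\alpha A)(m,n)|\leq C_{N,\alpha}(1+|m|+|n|)^{r-|\alpha|}(1+|m-n|)^{-N}$ for all $m,n\in\mathbb{Z}^d$. *)

(* Defs.v *)
From HB Require Import structures.
From mathcomp Require Import all_boot all_order all_algebra finmap complex.
From mathcomp Require Import all_classical all_reals all_analysis.
From mathcomp Require summability.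

Set Implicit Arguments.
Unset Strict Implicit.
Unset Printing Implicit Defensive.
Import Order.TTheory GRing.Theory Num.Theory.
Import numFieldNormedType.Exports.

Local Open Scope classical_set_scope.
Local Open Scope ring_scope.
Local Open Scope complex_scope.

(** Points of R^d and of Z^d are row vectors.  Complex numbers are [R[i]], whose
    norm and order take values in [R[i]]: a bound of |z| by a real [c] is written
    [`|z| <= c%:C]. *)

Definition basis_vec (K : pzRingType) (d : nat) (j : 'I_d) : 'rV[K]_d :=
  delta_mx 0 j.

Section Calculus.
Variables (R : realType) (d : nat).
Implicit Types (f V Phi : 'rV[R]_d -> R[i]) (x : 'rV[R]_d) (j : 'I_d).

(** [R[i]] is not a normed module over [R] in the library, so derivatives (and
    below, integrals) are taken on real and imaginary parts. *)
Definition pderiv j f : 'rV[R]_d -> R[i] := fun x =>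
  'D_(basis_vec R j) (fun y => complex.Re (f y)) x
  +i* 'D_(basis_vec R j) (fun y => complex.Im (f y)) x.

Definition pderivable j f : Prop := forall x,
  derivable (fun y => complex.Re (f y)) x (basis_vec R j) /\
  derivable (fun y => complex.Im (f y)) x (basis_vec R j).

(** C^oo: the iterated partial derivatives along every word of directions exist
    and are continuous. *)
Definition smooth f : Prop := forall s : seq 'I_d,
  continuous (foldr pderiv f s : 'rV[R]_d -> R[i]^o) /\ forall j, pderivable j (foldr pderiv f s).

Definition mderiv (alpha : 'I_d -> nat) f : 'rV[R]_d -> R[i] :=
  foldr (fun j g => iter (alpha j) (pderiv j) g) f (enum 'I_d).

Definition msize (alpha : 'I_d -> nat) : nat := (\sum_j alpha j)%N.

Definition japanese x : R := Num.sqrt (1 + \sum_j x 0 j ^+ 2).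

Definition symbol_bounds (r : R) Phi : Prop :=
  forall alpha : 'I_d -> nat, exists c : R, forall x,
    `|mderiv alpha Phi x| <= (c * japanese x `^ (r - (msize alpha)%:R))%:C.

(** Functions on the torus (R/2piZ)^d are the functions on R^d that are
    2pi-periodic in each coordinate. *)
Definition torus_fun V : Prop :=
  forall j, periodic V ((2 * pi) *: basis_vec R j).

Definition set_coord j x (t : R) : 'rV[R]_d :=
  \row_i (if i == j then t else x 0 i).

Definition coord_int j (g : 'rV[R]_d -> R) : 'rV[R]_d -> R := fun x =>
  \int[lebesgue_measure]_(t in `[0, 2 * pi]) g (set_coord j x t).

(** Integral over [0, 2pi]^d as an iterated Lebesgue integral; all coordinates
    are integrated out, so the evaluation point 0 is irrelevant. *)
Definition torus_int (g : 'rV[R]_d -> R) : R :=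
  foldr coord_int g (enum 'I_d) 0.

Definition torus_cint f : R[i] :=
  torus_int (fun x => complex.Re (f x)) +i* torus_int (fun x => complex.Im (f x)).

(** e^(it) *)
Definition cis (t : R) : R[i] := cos t +i* sin t.

Definition dotZ (k : 'rV[int]_d) x : R := \sum_j (k 0 j)%:~R * x 0 j.

Definition fourier V (k : 'rV[int]_d) : R[i] :=
  ((2 * pi) ^- d)%:C * torus_cint (fun x => cis (- dotZ k x) * V x).

End Calculus.

Section InfiniteMatrices.
Variables (R : realType) (d : nat).

Definition imatrix : Type := 'rV[int]_d -> 'rV[int]_d -> R[i].

Implicit Types (A B : imatrix) (m n k : 'rV[int]_d) (j : 'I_d).

Definition normZ k : nat := (\sum_j `|k 0%R j|)%N.

Definition imx1 : imatrix := fun m n => (m == n)%:R.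

Definition diag_imx (Phi : 'rV[R]_d -> R[i]) : imatrix := fun m n =>
  Phi (map_mx intr m) * (m == n)%:R.

Definition conv_imx (V : 'rV[R]_d -> R[i]) : imatrix := fun m n =>
  fourier V (m - n).

(** Sums over Z^d are unordered sums: limits of the finite partial sums along
    the filter of finite subsets of Z^d ordered by inclusion (for complex
    families, such a sum converges iff it converges absolutely). *)
Definition imx_mul A B : imatrix := fun m n =>
  @summability.sum _ _ R[i]^o (fun k : 'rV[int]_d => A m k * B k n).

Definition imx_mul_cvg A B : Prop := forall m n,
  cvg (summability.partial_sum (fun k : 'rV[int]_d => A m k * B k n : R[i]^o)
         @ summability.totally).

(** M_0 (M_1 (... (M_(P-1) 1))) *)
Definition imx_prod (P : nat) (M : 'I_P -> imatrix) : imatrix :=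
  \big[imx_mul/imx1]_(i < P) M i.

(** All the series occurring in [imx_prod] converge. *)
Definition imx_prod_cvg (P : nat) (M : 'I_P -> imatrix) : Prop :=
  forall i : 'I_P, imx_mul_cvg (M i) (\big[imx_mul/imx1]_(l < P | (i < l)%N) M l).

Definition shift_diff (v : 'rV[int]_d) A : imatrix := fun m n =>
  A (m + v) (n + v) - A m n.

Definition Delta1 j (a : int) A : imatrix :=
  if 0 <= a then iter `|a|%N (shift_diff (basis_vec int j)) A
  else iter `|a|%N (shift_diff (- basis_vec int j)) A.

Definition Delta (alpha : 'rV[int]_d) A : imatrix :=
  foldr (fun j B => Delta1 j (alpha 0 j) B) A (enum 'I_d).

Definition in_class (r : R) A : Prop :=
  forall (alpha : 'rV[int]_d) (N : nat), exists C : R, 0 <= C /\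
    forall m n, `|Delta alpha A m n| <=
      (C * (1 + (normZ m)%:R + (normZ n)%:R) `^ (r - (normZ alpha)%:R)
         * (1 + (normZ (m - n))%:R) ^- N)%:C.

End InfiniteMatrices.

(* Main.v *)
From HB Require Import structures.
Require Import Defs.
From mathcomp Require Import all_boot all_order all_algebra finmap complex.
From mathcomp Require Import all_classical all_reals all_analysis.
From mathcomp Require Import ring lra.
From mathcomp Require summability.

Set Implicit Arguments.
Unset Strict Implicit.
Unset Printing Implicit Defensive.
Import Order.TTheory GRing.Theory Num.Theory.
Import numFieldNormedType.Exports.

Local Open Scope classical_set_scope.
Local Open Scope ring_scope.
Local Open Scope complex_scope.

(** Each factor is explicit: the sum in [A_Phi B_V] has a single nonzero term, so
    the factor is the matrix [Phi m * fourier V (m - n)].  A diagonal shift leaves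
    [m - n] unchanged, so differencing the factor amounts to differencing [Phi]
    along the lattice.  The theorem then follows from three facts.

    Symbols ([symbol_step_diff]): by the mean value inequality, a difference of
    order [a] of [Phi] at a lattice point is controlled by the partial derivatives
    of order [a] nearby, hence by [(1 + |m|)^(r - a)].

    Fourier coefficients ([fourier_decay]): they decay faster than any power.
    Rather than integrating by parts, translate by half a wavelength: with
    [h = pi / k_j], the wave [e^(-ik.x)] changes sign under the translation by
    [h e_j], so the N-th difference of [V] with step [h e_j] has [k]-th coefficient
    [(-2)^N] times that of [V], whereas this difference is [O(h^N)], that is
    [O(|k_j|^-N)].  This only uses the linearity of the iterated integral, a sup
    bound and translation invariance; all three hold on periodic functions that
    are Lipschitz along the axes, a class stable under partial integration.

    The classes form a graded algebra ([word_class_mul]).  At order zero, Peetre's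
    inequality ([bracket2_powR]) replaces the weights of both factors by
    [1 + |m| + |n|], at the price of powers of [1 + |m - k|] and [1 + |k - n|] paid
    by the off-diagonal decay, and the remaining power of [1 + |k - n|] is summable
    over the lattice ([lattice_sum_shift_le]); this also gives the convergence of
    all the series.  Differences are reduced to order zero by the Leibniz rule
    [D(AB) = DA B + DA DB + A DB] ([shift_diff_mul]).

    The identity matrix is in the class of order 0, and the theorem follows by
    induction on the number of factors. *)

(** * Moduli, real powers and lattice weights *)

Section Absz.
Variable R : realType.
Implicit Types (z w : R[i]).

(** The norm of [R[i]] takes values in [R[i]]; [cabs] is the same modulus, real
    valued, so that bounds can be handled by real arithmetic. *)
Definition cabs z : R := complex.Re `|z|.

Lemma cabsE z : `|z| = (cabs z)%:C.
Proof. by rewrite /cabs normc_def. Qed.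

Lemma cabs_leE z (c : R) : (`|z| <= c%:C) = (cabs z <= c).
Proof. by rewrite cabsE lecR. Qed.

Lemma cabs_ge0 z : 0 <= cabs z.
Proof. by rewrite -ler0c -cabsE. Qed.

Lemma cabsD z w : cabs (z + w) <= cabs z + cabs w.
Proof. by rewrite -lecR rmorphD /= -!cabsE ler_normD. Qed.

Lemma cabsN z : cabs (- z) = cabs z.
Proof. by rewrite /cabs normrN. Qed.

Lemma cabsM z w : cabs (z * w) = cabs z * cabs w.
Proof. by apply: complexI; rewrite rmorphM /= -!cabsE normrM. Qed.

Lemma cabsX z n : cabs (z ^+ n) = cabs z ^+ n.
Proof. by apply: complexI; rewrite rmorphXn /= -!cabsE normrX. Qed.

Lemma cabs_real (x : R) : cabs x%:C = `|x|.
Proof.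
by rewrite /cabs normc_def /= expr0n addr0 sqrtr_sqr.
Qed.

Lemma cabs0 : cabs 0 = 0. Proof. by rewrite /cabs normr0. Qed.
Lemma cabs1 : cabs 1 = 1. Proof. by rewrite /cabs normr1. Qed.

Lemma cabs_nat n : cabs n%:R = n%:R.
Proof. by rewrite /cabs normr_nat -[n%:R](rmorph_nat (real_complex R)). Qed.

Lemma le_Re_cabs z : `|complex.Re z| <= cabs z.
Proof. by rewrite -lecR -cabsE normc_ge_Re. Qed.

Lemma le_Im_cabs z : `|complex.Im z| <= cabs z.
Proof.
case: z => a b /=; rewrite /cabs normc_def /= -[leLHS]sqrtr_sqr.
by rewrite ler_wsqrtr // lerDr sqr_ge0.
Qed.

Lemma cabs_le_ReIm z : cabs z <= `|complex.Re z| + `|complex.Im z|.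
Proof.
case: z => a b /=; rewrite /cabs normc_def /=.
rewrite -[leRHS]ger0_norm ?addr_ge0 // -sqrtr_sqr ler_wsqrtr //.
rewrite sqrrD !real_normK ?num_real // lerD2r lerDl.
by rewrite mulrn_wge0 // mulr_ge0.
Qed.

End Absz.

Section Powers.
Variable R : realType.

(** Two positive quantities within a factor [K] of each other have comparable
    powers, for exponents of either sign; all the comparisons of weights below are
    instances of this. *)
Lemma powR_comparable (a b K s : R) : 0 < a -> 0 < b ->
  a <= K * b -> b <= K * a -> a `^ s <= K `^ `|s| * b `^ s.
Proof.
move=> a0 b0 aKb bKa.
have K0 : 0 < K by rewrite -(pmulr_lgt0 _ b0); exact: lt_le_trans aKb.
have [s0|s0] := leP 0 s.
  rewrite ger0_norm // -powRM ?(ltW K0) ?(ltW b0) //.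
  by apply: ge0_ler_powR => //; rewrite nnegrE ?mulr_ge0 // ltW.
have ns0 : 0 <= - s by rewrite oppr_ge0 ltW.
have h : b `^ (- s) <= K `^ (- s) * a `^ (- s).
  rewrite -powRM ?(ltW K0) ?(ltW a0) //.
  by apply: ge0_ler_powR => //; rewrite nnegrE ?mulr_ge0 // ltW.
rewrite ltr0_norm // -[s in a `^ s]opprK -[s in b `^ s]opprK.
rewrite (powRN a (- s)) (powRN b (- s)).
rewrite ler_pdivlMr ?powR_gt0 // mulrC ler_pdivrMr ?powR_gt0 //.
Qed.

End Powers.

Section Weights.
Variables (R : realType) (d : nat).
Implicit Types m n k : 'rV[int]_d.

Lemma normZD m n : (normZ (m + n) <= normZ m + normZ n)%N.
Proof.
rewrite /normZ -big_split /=; apply: leq_sum => j _.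
by rewrite mxE -lez_nat PoszD !abszE ler_normD.
Qed.

Lemma normZN m : normZ (- m) = normZ m.
Proof. by apply: eq_bigr => j _; rewrite mxE abszN. Qed.

Lemma normZB m n : normZ (m - n) = normZ (n - m).
Proof. by rewrite -normZN opprB. Qed.

Lemma normZ0 : normZ (0 : 'rV[int]_d) = 0%N.
Proof. by rewrite /normZ big1 // => j _; rewrite mxE. Qed.

(** [bracket] measures the distance to the diagonal when applied to [m - n], and
    [bracket2] is the weight that carries the order of a matrix. *)
Definition bracket k : R := 1 + (normZ k)%:R.

Definition bracket2 m n : R := 1 + (normZ m)%:R + (normZ n)%:R.

Lemma bracket_ge1 k : 1 <= bracket k.
Proof. by rewrite /bracket lerDl. Qed.

Lemma bracket_gt0 k : 0 < bracket k.
Proof. exact: lt_le_trans (bracket_ge1 k). Qed.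

Lemma bracket2_ge1 m n : 1 <= bracket2 m n.
Proof. by rewrite /bracket2 -addrA lerDl addr_ge0. Qed.

Lemma bracket2_gt0 m n : 0 < bracket2 m n.
Proof. exact: lt_le_trans (bracket2_ge1 m n). Qed.

Lemma bracketN k : bracket (- k) = bracket k.
Proof. by rewrite /bracket normZN. Qed.

Lemma bracketD m n : bracket (m + n) <= bracket m * bracket n.
Proof.
rewrite /bracket mulrDl mul1r mulrDr mulr1.
have : ((normZ (m + n))%:R <= (normZ m)%:R + (normZ n)%:R :> R).
  by rewrite -natrD ler_nat normZD.
have : 0 <= (normZ m)%:R * (normZ n)%:R :> R by rewrite mulr_ge0.
by lra.
Qed.

Lemma bracket2C m n : bracket2 m n = bracket2 n m.
Proof. by rewrite /bracket2 addrAC. Qed.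

Lemma bracket2_shift m n k : bracket2 m k <= bracket (k - n) * bracket2 m n.
Proof.
rewrite /bracket2 /bracket mulrDl mul1r.
have : ((normZ k)%:R <= (normZ (k - n)%R)%:R + (normZ n)%:R :> R).
  by rewrite -natrD ler_nat -{1}[k](subrK n) normZD.
have : 0 <= (normZ (k - n))%:R * ((normZ m)%:R + (normZ n)%:R) :> R.
  by rewrite mulr_ge0 // addr_ge0.
by lra.
Qed.

(** Peetre's inequality: moving one index costs the power [`|s|] of the distance
    moved, whatever the sign of [s]. *)
Lemma bracket2_powR s m n k :
  bracket2 m k `^ s <= bracket (k - n) `^ `|s| * bracket2 m n `^ s.
Proof.
apply: powR_comparable; rewrite ?bracket2_gt0 //; first exact: bracket2_shift.
by rewrite -bracketN opprB bracket2_shift.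
Qed.

(** Symbols are controlled by the row index alone; passing to the weight in both
    indices again costs a power of the distance to the diagonal. *)
Lemma bracket_powR_le s m n :
  bracket m `^ s <= 2 `^ `|s| * bracket (m - n) `^ `|s| * bracket2 m n `^ s.
Proof.
have h1 := bracket_ge1 (m - n); have h2 := bracket_gt0 (m - n).
rewrite -powRM ?(ltW h2) //.
apply: powR_comparable; rewrite ?bracket_gt0 ?bracket2_gt0 //.
- apply: (@le_trans _ _ (bracket2 m n)); first by rewrite /bracket /bracket2 lerDl.
  by rewrite ler_peMl ?(ltW (bracket2_gt0 _ _)) //; lra.
- have : ((normZ n)%:R <= (normZ (m - n)%R)%:R + (normZ m)%:R :> R).
    by rewrite -natrD ler_nat normZB -{1}[n](subrK m) normZD.
  have : 0 <= (normZ (m - n))%:R * ((normZ m)%:R) :> R by rewrite mulr_ge0.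
  have : 0 <= (normZ (m - n))%:R :> R by [].
  by rewrite /bracket2 /bracket; nra.
Qed.

(** Off-diagonal decay is measured with natural exponents, and has to absorb the
    real exponents that come from Peetre's inequality. *)
Lemma bracket_powR_nat s : exists N : nat, forall k, bracket k `^ s <= bracket k ^+ N.
Proof.
exists (Num.bound `|s|) => k.
rewrite -powR_mulrn ?(ltW (bracket_gt0 _)) //.
apply: ler_powR; first exact: bracket_ge1.
by apply: le_trans (ler_norm s) _; rewrite ltW // archi_boundP.
Qed.

End Weights.

(** * Finite differences and the mean value inequality *)

(** Symbol bounds concern derivatives taken in the order of the axes, while
    differences are taken along arbitrary words; commutation allows to reorder the
    latter. *)
Lemma foldr_perm (T : eqType) (S : Type) (op : T -> S -> S) :
  (forall p q x, op p (op q x) = op q (op p x)) ->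
  forall s1 s2 x, perm_eq s1 s2 -> foldr op x s1 = foldr op x s2.
Proof.
move=> opC; have rem_first p s x : p \in s -> foldr op x s = op p (foldr op x (rem p s)).
  elim: s => //= q s IH; rewrite inE; have [->//|/negPf qp] := eqVneq q p.
  by move=> ps; rewrite /= opC -IH //; move: ps; rewrite eq_sym qp.
elim=> [|p s1 IH] s2 x; first by rewrite perm_sym => /perm_nilP ->.
move=> ps; have ps2 : p \in s2 by rewrite -(perm_mem ps) mem_head.
rewrite (rem_first p s2) //= (IH (rem p s2)) // -(perm_cons p).
by rewrite (perm_trans ps) // perm_to_rem.
Qed.

Section DeriveShift.
Variables (R : realType) (V : normedModType R).
Implicit Types (g : V -> R) (a x v : V).

Let quot_shift g a x v :
  (fun h : R => h^-1 *: (((fun y => g (y + a)) \o shift x) (h *: v) - g (x + a))) =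
  (fun h : R => h^-1 *: ((g \o shift (x + a)) (h *: v) - g (x + a))).
Proof. by apply/funext => h /=; rewrite addrA. Qed.

Lemma derive_shift g a x v : 'D_v (fun y => g (y + a)) x = 'D_v g (x + a).
Proof. by rewrite /derive quot_shift. Qed.

Lemma derivable_shift g a x v :
  derivable g (x + a) v -> derivable (fun y => g (y + a)) x v.
Proof. by rewrite /derivable quot_shift. Qed.

End DeriveShift.

Lemma mvt_le (R : realType) (u u' : R -> R) (s t M : R) :
  (forall z : R, is_derive z 1 u (u' z)) ->
  (forall z, `|z - s| <= `|t| -> `|u' z| <= M) ->
  `|u (s + t) - u s| <= `|t| * M.
Proof.
move=> du hu.
have cu : forall a b : R, {within `[a, b], continuous u}.
  by move=> a b; apply: derivable_within_continuous => z _; have [] := du z.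
have [t0|t0] := leP 0 t.
  have st : s <= s + t by rewrite lerDl.
  have [c] := MVT_segment st (fun z _ => du z) (cu _ _).
  rewrite in_itv /= => /andP[sc ct] ->.
  rewrite addrAC subrr add0r normrM mulrC ler_wpM2l // hu //.
  by rewrite !ger0_norm ?subr_ge0 // lerBlDl.
have st : s + t <= s by rewrite gerDl ltW.
have [c] := MVT_segment st (fun z _ => du z) (cu _ _).
rewrite distrC in_itv /= => /andP[tc cs] ->.
rewrite opprD addrA subrr add0r normrM normrN mulrC ler_wpM2l // hu //.
by rewrite !ler0_norm ?subr_le0 ?(ltW t0) // lerN2 lerBrDl.
Qed.

Section FiniteDifferences.
Variables (R : realType) (d : nat).
Implicit Types (f : 'rV[R]_d -> R[i]) (x y : 'rV[R]_d) (j : 'I_d) (p : 'I_d * R).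

(** Differences with arbitrary real steps: the steps are +1 or -1 for symbols, and
    half a wavelength for Fourier coefficients. *)
Definition step_diff p f : 'rV[R]_d -> R[i] := fun x =>
  f (x + p.2 *: basis_vec R p.1) - f x.

Lemma step_diffC p q f : step_diff p (step_diff q f) = step_diff q (step_diff p f).
Proof.
apply/funext => x; rewrite /step_diff (addrAC x (p.2 *: _)).
by rewrite !opprB addrACA [RHS]addrACA (addrC (- f _) (- f _)).
Qed.

(** The first difference can be taken last: this is what lets the induction of
    [foldr_step_diff_le] produce the partial derivatives in the order of the word. *)
Lemma step_diff_foldr p f w :
  foldr step_diff f (p :: w) = foldr step_diff (step_diff p f) w.
Proof. by elim: w => //= q w <- ; rewrite step_diffC. Qed.

(** The part of smoothness that the mean value inequality needs. *)
Definition pd_smooth f : Prop := forall s j, pderivable j (foldr (@pderiv R d) f s).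

Lemma smooth_pd f : smooth f -> pd_smooth f.
Proof. by move=> hf s j; have [] := hf s. Qed.

Lemma Re_step_diff p f : (fun y => complex.Re (step_diff p f y)) =
  (fun y => complex.Re (f (y + p.2 *: basis_vec R p.1))) - (fun y => complex.Re (f y)).
Proof. by apply/funext => y; rewrite /step_diff raddfB. Qed.

Lemma Im_step_diff p f : (fun y => complex.Im (step_diff p f y)) =
  (fun y => complex.Im (f (y + p.2 *: basis_vec R p.1))) - (fun y => complex.Im (f y)).
Proof. by apply/funext => y; rewrite /step_diff raddfB. Qed.

Lemma pderivable_step_diff j p f : pderivable j f -> pderivable j (step_diff p f).
Proof.
move=> hf x; have [hr hi] := hf x; have [hr' hi'] := hf (x + p.2 *: basis_vec R p.1).
rewrite Re_step_diff Im_step_diff.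
split; apply: derivableB.
- exact: (derivable_shift hr').
- exact: hr.
- exact: (derivable_shift hi').
- exact: hi.
Qed.

Lemma pderiv_step_diff j p f :
  pderivable j f -> pderiv j (step_diff p f) = step_diff p (pderiv j f).
Proof.
move=> hf; apply/funext => x; have [hr hi] := hf x.
have [hr' hi'] := hf (x + p.2 *: basis_vec R p.1).
rewrite /pderiv Re_step_diff Im_step_diff.
rewrite (deriveB (derivable_shift hr') hr) (deriveB (derivable_shift hi') hi).
by rewrite (derive_shift (fun y => complex.Re (f y)))
  (derive_shift (fun y => complex.Im (f y))).
Qed.

Lemma foldr_pderiv_step_diff p f s : pd_smooth f ->
  foldr (@pderiv R d) (step_diff p f) s = step_diff p (foldr (@pderiv R d) f s).
Proof.
move=> hf; elim: s => //= j s ->; exact/pderiv_step_diff/hf.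
Qed.

Lemma pd_smooth_step_diff p f : pd_smooth f -> pd_smooth (step_diff p f).
Proof.
move=> hf s j; rewrite foldr_pderiv_step_diff //.
exact/pderivable_step_diff/hf.
Qed.

Lemma is_derive_line (g : 'rV[R]_d -> R) x v :
  (forall y, derivable g y v) -> forall t : R,
  is_derive t 1 (fun s => g (x + s *: v)) ('D_v g (x + t *: v)).
Proof.
move=> hg t; have E : (fun h : R => h^-1 *: (((fun s : R => g (x + s *: v)) \o shift t)
    (h *: (1 : R)) - g (x + t *: v))) =
  (fun h : R => h^-1 *: ((g \o shift (x + t *: v)) (h *: v) - g (x + t *: v))).
  apply/funext => h /=; congr (_ *: (g _ - _)).
  by rewrite scalerDl [h *: 1]mulr1 addrCA.
split; first by rewrite /derivable E; exact: hg.
by rewrite /derive E.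
Qed.

Lemma mvt_line (g : 'rV[R]_d -> R) x v (h M : R) :
  (forall y, derivable g y v) ->
  (forall t, `|t| <= `|h| -> `|'D_v g (x + t *: v)| <= M) ->
  `|g (x + h *: v) - g x| <= `|h| * M.
Proof.
move=> hg hM.
have := @mvt_le _ (fun t : R => g (x + t *: v)) (fun t : R => 'D_v g (x + t *: v))
  0 h M (is_derive_line x hg).
rewrite add0r scale0r addr0; apply=> t; rewrite subr0; exact: hM.
Qed.

Definition within_box (L : R) x y := forall i, `|y 0 i - x 0 i| <= L.

(** The mean value theorem fails for complex values; applying it to the real and
    imaginary parts costs a factor 2. *)
Lemma mvt_step j f x (h M : R) : pderivable j f ->
  (forall y, within_box `|h| x y -> cabs (pderiv j f y) <= M) ->
  cabs (f (x + h *: basis_vec R j) - f x) <= 2 * `|h| * M.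
Proof.
move=> hf hM; apply: le_trans (cabs_le_ReIm _) _.
have box t : `|t| <= `|h| -> within_box `|h| x (x + t *: basis_vec R j).
  move=> th i; rewrite /basis_vec !mxE /= addrAC subrr add0r.
  by case: eqP => _; rewrite ?mulr1 // mulr0 normr0.
rewrite -mulrA mulr2n mulrDl mul1r; apply: lerD.
- rewrite raddfB; apply: (@mvt_line (fun y => complex.Re (f y))) => [y|t th].
    by have [] := hf y.
  exact: le_trans (le_Re_cabs (pderiv j f _)) (hM _ (box _ th)).
- rewrite raddfB; apply: (@mvt_line (fun y => complex.Im (f y))) => [y|t th].
    by have [] := hf y.
  exact: le_trans (le_Im_cabs (pderiv j f _)) (hM _ (box _ th)).
Qed.

(** Differences commute with partial derivatives, so each difference of the word
    can be traded for a partial derivative by one use of [mvt_step]. *)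
Lemma foldr_step_diff_le w f x (M : R) : pd_smooth f ->
  (forall y, within_box (\sum_(p <- w) `|p.2|) x y ->
     cabs (foldr (@pderiv R d) f (map fst w) y) <= M) ->
  cabs (foldr step_diff f w x) <= (\prod_(p <- w) (2 * `|p.2|)) * M.
Proof.
elim: w f x M => [|p w IH] f x M hf hM.
  rewrite big_nil mul1r /=; apply: hM => i.
  by rewrite subrr normr0 big_nil.
rewrite step_diff_foldr big_cons [X in X * M]mulrC -mulrA.
apply: IH; first exact: pd_smooth_step_diff.
move=> y hy; rewrite foldr_pderiv_step_diff //.
apply: mvt_step; first exact: hf.
move=> z hz; apply: hM => i; rewrite big_cons.
rewrite -(subrK (y 0 i) (z 0 i)) -addrA.
by rewrite (le_trans (ler_normD _ _)) // lerD.
Qed.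

End FiniteDifferences.

(** * Differences of symbols on the lattice *)

Section Grouping.
Variables (d : nat) (T : Type).
Implicit Types (w : seq ('I_d * T)) (j : 'I_d).

(** The word rearranged in the order of the axes, the one in which [mderiv] takes
    its derivatives. *)
Definition group_by_dir w := flatten [seq [seq p <- w | p.1 == j] | j <- enum 'I_d].

Lemma foldr_group_by_dir (S : Type) (op : 'I_d -> S -> S) x w :
  foldr op x (map fst (group_by_dir w)) =
  foldr (fun j => iter (count (fun p => p.1 == j) w) (op j)) x (enum 'I_d).
Proof.
have block j y : foldr op y (map fst [seq p <- w | p.1 == j]) =
    iter (count (fun p => p.1 == j) w) (op j) y.
  elim: w => //= p w IH; case: eqP => [e|_]; first by rewrite /= e IH.
  by rewrite add0n IH.
rewrite /group_by_dir; elim: (enum _) => //= j s <-.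
by rewrite map_cat foldr_cat block.
Qed.

End Grouping.

Lemma perm_group_by_dir (d : nat) (T : eqType) (w : seq ('I_d * T)) :
  perm_eq w (group_by_dir w).
Proof.
apply/permP => a; rewrite /group_by_dir count_flatten -map_comp sumnE big_map big_enum /=.
elim: w => [|p w IH] /=; first by rewrite big1.
rewrite IH [RHS](eq_bigr (fun j => ((p.1 == j) * a p)%N + count a [seq q <- w | q.1 == j])%N); last first.
  by move=> j _; case: eqP => _ /=; rewrite ?mul1n ?mul0n ?add0n.
rewrite big_split /= -big_distrl /=; congr (_ + _)%N.
by rewrite (bigD1 p.1) //= eqxx big1 ?addn0 ?mul1n // => j /negPf; rewrite eq_sym => ->.
Qed.

Section Symbols.
Variables (R : realType) (d : nat).
Implicit Types (Phi : 'rV[R]_d -> R[i]) (x y : 'rV[R]_d) (m : 'rV[int]_d).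

(** A letter [(j, b)] stands for the unit step along axis [j], backwards when [b]
    is true; [sgn_step] and [sgn_vec] read it in the real and in the integer
    lattice. *)
Definition sgn_step (a : 'I_d * bool) : 'I_d * R := (a.1, (-1) ^+ a.2).
Definition sgn_vec (a : 'I_d * bool) : 'rV[int]_d := (-1) ^+ a.2 *: basis_vec int a.1.

Lemma map_sgn_vec a :
  map_mx intr (sgn_vec a) = (sgn_step a).2 *: basis_vec R (sgn_step a).1.
Proof.
by apply/rowP => i; rewrite /basis_vec !mxE rmorphM /= rmorphXn rmorphN1 rmorph_nat.
Qed.

Lemma japanese_ge1 x : 1 <= japanese x.
Proof.
rewrite -[leLHS]sqrtr1 ler_wsqrtr // lerDl sumr_ge0 // => j _; exact: sqr_ge0.
Qed.

Lemma le_coord_japanese x i : `|x 0 i| <= japanese x.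
Proof.
rewrite -sqrtr_sqr ler_wsqrtr // (bigD1 i) //= addrCA lerDl addr_ge0 //.
by rewrite sumr_ge0 // => j _; exact: sqr_ge0.
Qed.

Lemma japanese_le_l1 x : japanese x <= 1 + \sum_i `|x 0 i|.
Proof.
set S := \sum_i _; have S0 : 0 <= S by exact: sumr_ge0.
have hS : \sum_j x 0 j ^+ 2 <= S ^+ 2.
  rewrite expr2 {1}/S mulr_suml; apply: ler_sum => i _.
  rewrite -real_normK ?num_real // expr2 ler_wpM2l //.
  by rewrite /S (bigD1 i) //= lerDl sumr_ge0.
rewrite -[leRHS]ger0_norm ?addr_ge0 // -sqrtr_sqr ler_wsqrtr //.
by rewrite sqrrD expr1n mul1r lerD // lerDl mulr2n addr_ge0.
Qed.

(** Over a box of fixed size, the weight of a symbol stays comparable to its value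
    at the center. *)
Lemma japanese_comparable (L : R) m x : 0 <= L -> within_box L (map_mx intr m) x ->
  let K := 1 + d%:R + d%:R * L in
  japanese x <= K * bracket R m /\ bracket R m <= K * japanese x.
Proof.
move=> L0 hx K.
have normE : (normZ m)%:R = \sum_i `|(m 0 i)%:~R| :> R.
  rewrite /normZ natr_sum; apply: eq_bigr => i _.
  by rewrite natr_absz intr_norm.
have sumL (F : 'I_d -> R) : \sum_i (F i + L) = \sum_i F i + d%:R * L.
  by rewrite big_split /= sumr_const card_ord mulr_natl.
have dL : 0 <= d%:R * L by rewrite mulr_ge0.
have d0 : 0 <= d%:R :> R by [].
split.
- apply: le_trans (japanese_le_l1 x) _.
  have h : \sum_i `|x 0 i| <= (normZ m)%:R + d%:R * L.
    rewrite normE -sumL; apply: ler_sum => i _.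
    have := hx i; rewrite !mxE => hi.
    by rewrite -(subrK (m 0 i)%:~R (x 0 i)) addrC (le_trans (ler_normD _ _)) // lerD2l.
  have n0 : 0 <= (normZ m)%:R :> R by [].
  have := mulr_ge0 d0 n0; have := mulr_ge0 dL n0; rewrite /K /bracket; nra.
- have J1 := japanese_ge1 x.
  have h : (normZ m)%:R <= d%:R * japanese x + d%:R * L.
    have -> : d%:R * japanese x = \sum_(i < d) japanese x.
      by rewrite sumr_const card_ord mulr_natl.
    rewrite normE -sumL; apply: ler_sum => i _.
    have := hx i; rewrite !mxE distrC => hi.
    rewrite -(subrK (x 0 i) (m 0 i)%:~R) addrC (le_trans (ler_normD _ _)) // lerD //.
    exact: le_coord_japanese.
  have := ler_peMr dL J1; rewrite /K /bracket; nra.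
Qed.

(** Rearranged in the order of the axes, the differences are bounded by the partial
    derivatives of the symbol in a box of side governed by [size w], where
    [japanese] is comparable to [bracket m]. *)
Lemma symbol_step_diff (r : R) Phi w : pd_smooth Phi -> symbol_bounds r Phi ->
  exists C : R, 0 <= C /\ forall m,
    cabs (foldr (@step_diff R d) Phi (map sgn_step w) (map_mx intr m)) <=
    C * bracket R m `^ (r - (size w)%:R).
Proof.
move=> hPhi hsym.
have [c hc] := hsym (fun j => count (fun p => p.1 == j) w).
have msizeE : msize (fun j => count (fun p => p.1 == j) w) = size w.
  rewrite (perm_size (perm_group_by_dir w)) size_flatten /shape -map_comp sumnE.
  by rewrite big_map big_enum /=; apply: eq_bigr => j _ /=; rewrite size_filter.
rewrite msizeE in hc; set s := r - _ in hc *.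
have c0 : 0 <= c.
  have := hc 0; rewrite cabs_leE => /(le_trans (cabs_ge0 _)).
  by rewrite pmulr_lge0 // powR_gt0 // (lt_le_trans _ (japanese_ge1 _)).
pose L : R := (size w)%:R; have L0 : 0 <= L by [].
pose K : R := 1 + d%:R + d%:R * L.
have sumE : \sum_(p <- map sgn_step (group_by_dir w)) `|p.2| = L.
  rewrite big_map (eq_bigr (fun=> 1)) => [|a _]; last by rewrite normrX normrN1 expr1n.
  by rewrite big_const_seq count_predT iter_addr_0 -(perm_size (perm_group_by_dir w)).
exists (\prod_(p <- map sgn_step (group_by_dir w)) (2 * `|p.2|) * (c * K `^ `|s|)).
split=> [|m].
  by rewrite mulr_ge0 ?prodr_ge0 ?mulr_ge0 ?powR_ge0 // => p _; rewrite mulr_ge0.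
rewrite (foldr_perm (@step_diffC R d) _ (perm_map _ (perm_group_by_dir w))) -!mulrA.
apply: foldr_step_diff_le => // y; rewrite sumE => hy.
have -> : map fst (map sgn_step (group_by_dir w)) = map fst (group_by_dir w).
  by rewrite -map_comp; apply: eq_map.
rewrite foldr_group_by_dir -cabs_leE; apply: le_trans (hc y) _.
rewrite lecR ler_wpM2l //.
have [h1 h2] := japanese_comparable L0 hy.
by apply: powR_comparable h1 h2; rewrite ?bracket_gt0 // (lt_le_trans _ (japanese_ge1 _)).
Qed.

End Symbols.

(** * Integrals of periodic functions over a period *)

Section PeriodicIntegral.
Variables (R : realType).
Implicit Types (u : R -> R) (a t h T : R).
Notation mu := (@lebesgue_measure R).

Lemma integrable_segment u (a b : R) : continuous u ->
  mu.-integrable `[a, b] (EFin \o u).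
Proof.
move=> cu; apply: continuous_compact_integrable; first exact: segment_compact.
exact: continuous_subspaceT.
Qed.

(** A primitive on a half-line suffices, since [a] can be taken to the left of all
    the points at stake. *)
Lemma primitive_right u a : continuous u ->
  exists F : R -> R, forall x, a < x -> is_derive x 1 F (u x).
Proof.
move=> cu; exists (fun x => \int[mu]_(t in `[a, x]) u t) => x ax.
have [|d1 d2] := @continuous_FTC1_closed R u a x (x + 1) _ (integrable_segment _ _ cu) ax (cu x).
  by rewrite ltrDl.
by split => //; rewrite -derive1E.
Qed.

Lemma Rintegral_primitive u (F : R -> R) h T : 0 < T -> continuous u ->
  (forall x, h <= x -> is_derive x 1 F (u x)) ->
  \int[mu]_(t in `[0, T]) u (t + h) = F (T + h) - F h.
Proof.
move=> T0 cu dF.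
have dFh (x : R) : 0 <= x -> is_derive x 1 (fun t : R => F (t + h)) (u (x + h)).
  move=> x0; have hx : h <= x + h by rewrite lerDr.
  have [d1 d2] := dF _ hx.
  by split; [exact: (derivable_shift d1)|rewrite derive_shift].
have cFh (x : R) : 0 <= x -> {for x, continuous (fun t : R => F (t + h))}.
  move=> x0; have [d1 _] := dFh _ x0.
  exact/differentiable_continuous/derivable1_diffP.
have H : (\int[mu]_(t in `[0%R, T]) (u (t + h))%:E = (F (T + h))%:E - (F (0 + h))%:E)%E.
  apply: (continuous_FTC2 (f := fun t => u (t + h)) (F := fun t => F (t + h))) => //.
  - apply: continuous_subspaceT => x.
    apply: (@continuous_comp _ _ _ (fun t => t + h) u); last exact: cu.
    by apply: cvgD; [exact: cvg_id|exact: cvg_cst].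
  - split.
    + by move=> x; rewrite in_itv /= => /andP[x0 _]; have [] := dFh x (ltW x0).
    + by apply: cvg_at_right_filter; exact: cFh.
    + by apply: cvg_at_left_filter; exact: (cFh T (ltW T0)).
  - move=> x; rewrite in_itv /= => /andP[x0 _]; have [_] := dFh x (ltW x0).
    by rewrite derive1E.
by rewrite /Rintegral H add0r.
Qed.

(** Both sides are increments of one primitive [F] over a period, and
    [F (T + s) - F s] has derivative [u (T + s) - u s = 0]. *)
Lemma Rintegral_periodic_shift u h T : 0 < T -> continuous u -> periodic u T ->
  \int[mu]_(t in `[0, T]) u (t + h) = \int[mu]_(t in `[0, T]) u t.
Proof.
move=> T0 cu pu; pose a := Num.min 0 h - 1.
have a0 : a < 0 by rewrite /a ltrBlDr add0r gt_min ltr01.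
have ah : a < h by rewrite /a ltrBlDr gt_min ltrDl ltr01 orbT.
have [F dF] := primitive_right a cu.
have inc (h' : R) : a < h' ->
    \int[mu]_(t in `[0, T]) u (t + h') = F (T + h') - F h'.
  move=> ah'; apply: Rintegral_primitive => // x hx.
  exact/dF/(lt_le_trans ah').
transitivity (\int[mu]_(t in `[0, T]) u (t + 0)); last first.
  by apply: eq_Rintegral => t _; rewrite addr0.
rewrite !inc //.
rewrite !(addrC T).
(* the increment of F over a period has zero derivative, hence is constant *)
have dG (s : R) : a < s -> is_derive s 1 ((fun s : R => F (s + T)) - F) 0.
  move=> as_; have as2 : a < s + T by rewrite (lt_trans as_) // ltrDl.
  have [d1 d2] := dF _ as_; have [d3 d4] := dF _ as2.
  have d5 := derivable_shift d3.
  split; first exact: derivableB.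
  by rewrite deriveB // derive_shift d4 d2 pu subrr.
have cst (x y : R) : a < x -> x <= y -> F (y + T) - F y = F (x + T) - F x.
  move=> ax xy.
  have dI (s : R) : s \in `[x, y] -> is_derive s 1 ((fun s : R => F (s + T)) - F) 0.
    by rewrite in_itv /= => /andP[xs _]; exact/dG/(lt_le_trans ax).
  have dI' s : s \in `]x, y[ -> is_derive s 1 ((fun s : R => F (s + T)) - F) 0.
    by rewrite in_itv /= => /andP[xs _]; exact/dG/(lt_trans ax).
  have cG : {within `[x, y], continuous ((fun s : R => F (s + T)) - F)}.
    by apply: derivable_within_continuous => s /dI[].
  have [s _] := @MVT_segment _ _ (fun=> 0) x y xy dI' cG.
  by rewrite mul0r => /eqP; rewrite subr_eq0 => /eqP.
have [h0|h0] := leP 0 h; first exact: cst.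
by apply/esym/cst => //; exact: ltW.
Qed.

End PeriodicIntegral.

(** * Iterated integrals over the torus *)

Section CoordinateIntegrals.
Variables (R : realType) (d : nat).
Implicit Types (g : 'rV[R]_d -> R) (x : 'rV[R]_d) (i j : 'I_d).
Notation mu := (@lebesgue_measure R).

(** The regularity on which the iterated integral is handled: unlike smoothness, it
    is inherited by partial integrals with no argument beyond a sup bound, and it
    makes every one-variable slice continuous, hence integrable. *)
Definition coord_lip g : Prop := exists L : R, 0 <= L /\
  forall j x t, `|g (x + t *: basis_vec R j) - g x| <= L * `|t|.

Lemma set_coord_shift j x (s t : R) :
  set_coord j x t + s *: basis_vec R j = set_coord j x (t + s).
Proof.
apply/rowP => i; rewrite /basis_vec !mxE /=; case: eqP => _; rewrite ?mulr1 //.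
by rewrite mulr0 addr0.
Qed.

Lemma set_coord_shift_same j x (s t : R) :
  set_coord j (x + s *: basis_vec R j) t = set_coord j x t.
Proof.
apply/rowP => i; rewrite /basis_vec !mxE /=; case: eqP => // _.
by rewrite mulr0 addr0.
Qed.

Lemma set_coord_shift_other i j x (s t : R) : i != j ->
  set_coord i (x + s *: basis_vec R j) t = set_coord i x t + s *: basis_vec R j.
Proof.
move=> ij; apply/rowP => l; rewrite /basis_vec !mxE /=.
by case: eqP => // ->; rewrite (negPf ij) mulr0 addr0.
Qed.

Lemma slice_continuous g j x : coord_lip g -> continuous (fun t : R => g (set_coord j x t)).
Proof.
move=> [L [L0 hL]] t; apply/cvgrPdist_le => e e0.
near=> t'.
have -> : set_coord j x t = set_coord j x t' + (t - t') *: basis_vec R j.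
  by rewrite set_coord_shift addrC subrK.
apply: le_trans (hL _ _ _) _.
have : `|t - t'| <= e / (L + 1).
  near: t'; apply: cvgr_dist_le; first exact: cvg_id.
  by rewrite divr_gt0 // ltr_wpDl.
rewrite ler_pdivlMr ?ltr_wpDl // mulrC; apply: le_trans.
by rewrite ler_wpM2r // lerDl.
Unshelve. all: by end_near. Qed.

Lemma slice_integrable g j x (a b : R) : coord_lip g ->
  mu.-integrable `[a, b] (EFin \o (fun t : R => g (set_coord j x t))).
Proof. by move=> hg; apply: integrable_segment; exact: slice_continuous. Qed.

Let twopi_ge0 : 0 <= 2 * pi :> R.
Proof. by rewrite mulr_ge0 // pi_ge0. Qed.

Lemma Rintegral_segment_le (u : R -> R) (M : R) :
  mu.-integrable `[0, 2 * pi] (EFin \o u) ->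
  (forall t, `|u t| <= M) -> `|\int[mu]_(t in `[0, 2 * pi]) u t| <= 2 * pi * M.
Proof.
move=> iu hM; apply: le_trans (le_normr_Rintegral _ iu) _ => //.
apply: (@le_trans _ _ (\int[mu]_(t in `[0, 2 * pi]) M)).
  apply: le_Rintegral => //.
  - exact/integrable_norm.
  - by apply: integrable_segment => t; exact: cvg_cst.
rewrite Rintegral_cst //= (lebesgue_measure_itv `[0, 2 * pi]) /= lte_fin.
case: ltP => _ /=; first by rewrite subr0 mulrC.
by rewrite mulr0 mulr_ge0 // (le_trans _ (hM 0)).
Qed.

Lemma coord_lip_shift g v : coord_lip g -> coord_lip (fun x => g (x + v)).
Proof.
move=> [L [L0 h]]; exists L; split=> // j x t.
by rewrite addrAC.
Qed.

Lemma coord_intD j g1 g2 : coord_lip g1 -> coord_lip g2 ->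
  coord_int j (fun x => g1 x + g2 x) = (fun x => coord_int j g1 x + coord_int j g2 x).
Proof.
move=> h1 h2; apply/funext => x.
by rewrite /coord_int RintegralD //; exact: slice_integrable.
Qed.

Lemma coord_intN j g : coord_lip g ->
  coord_int j (fun x => - g x) = (fun x => - coord_int j g x).
Proof.
move=> h; apply/funext => x; rewrite /coord_int.
under eq_Rintegral do rewrite -mulN1r.
by rewrite RintegralZl ?mulN1r //; exact: slice_integrable.
Qed.

Lemma coord_int_le j g (M : R) x : coord_lip g -> (forall x, `|g x| <= M) ->
  `|coord_int j g x| <= 2 * pi * M.
Proof.
by move=> h hM; apply: Rintegral_segment_le => //; exact: slice_integrable.
Qed.

(** The integrated coordinate of the evaluation point is overwritten. *)
Lemma coord_int_indep j g x t : coord_int j g (x + t *: basis_vec R j) = coord_int j g x.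
Proof. by apply: eq_Rintegral => s _; rewrite set_coord_shift_same. Qed.

Lemma coord_int_shift_other i j g x t : i != j ->
  coord_int i g (x + t *: basis_vec R j) =
  coord_int i (fun y => g (y + t *: basis_vec R j)) x.
Proof. by move=> ij; apply: eq_Rintegral => s _; rewrite set_coord_shift_other. Qed.

Lemma coord_int_lip j g : coord_lip g -> coord_lip (coord_int j g).
Proof.
move=> hg; have [L [L0 hL]] := hg.
exists (2 * pi * L); split=> [|i x t]; first exact: mulr_ge0.
have [<-|ji] := eqVneq j i; first by rewrite coord_int_indep subrr normr0 mulr_ge0 ?(mulr_ge0 twopi_ge0).
have i1 := slice_integrable j x 0 (2 * pi) (coord_lip_shift (t *: basis_vec R i) hg).
have i2 := slice_integrable j x 0 (2 * pi) hg.
rewrite coord_int_shift_other // /coord_int -RintegralB //.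
rewrite -mulrA; apply: Rintegral_segment_le => //.
exact: (integrableB _ i1 i2).
Qed.

Definition coord_periodic g : Prop := forall j, periodic g ((2 * pi) *: basis_vec R j).

Lemma coord_int_periodic j g : coord_periodic g -> coord_periodic (coord_int j g).
Proof.
move=> hg i x; have [->|ij] := eqVneq i j; first exact: coord_int_indep.
rewrite coord_int_shift_other 1?eq_sym //.
by congr coord_int; apply/funext => y; exact: hg.
Qed.

(** Along another axis this is a change of names; along the axis of integration
    both sides are the integral over one period of the same periodic slice. *)
Lemma coord_int_shift i j g t : coord_lip g -> coord_periodic g ->
  coord_int i (fun y => g (y + t *: basis_vec R j)) =
  (fun x => coord_int i g (x + t *: basis_vec R j)).
Proof.
move=> hg pg; apply/funext => x.
have [->|ij] := eqVneq i j; last by rewrite coord_int_shift_other.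
rewrite coord_int_indep /coord_int.
under eq_Rintegral do rewrite set_coord_shift.
apply: (Rintegral_periodic_shift (u := fun s => g (set_coord j x s))).
- by rewrite mulr_gt0 // pi_gt0.
- exact: slice_continuous.
- by move=> s; rewrite -set_coord_shift; exact: pg.
Qed.

(** Only the list [enum 'I_d] matters in the end, with evaluation at 0, but the
    inductions run over arbitrary lists and points. *)
Definition iter_int (s : seq 'I_d) g := foldr (@coord_int R d) g s.

Lemma iter_int_lip (s : seq 'I_d) g : coord_lip g -> coord_lip (iter_int s g).
Proof. by move=> hg; elim: s => //= j s; exact: coord_int_lip. Qed.

Lemma iter_int_periodic (s : seq 'I_d) g :
  coord_periodic g -> coord_periodic (iter_int s g).
Proof. by move=> hg; elim: s => //= j s; exact: coord_int_periodic. Qed.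

Lemma iter_intD (s : seq 'I_d) g1 g2 : coord_lip g1 -> coord_lip g2 ->
  iter_int s (fun x => g1 x + g2 x) = (fun x => iter_int s g1 x + iter_int s g2 x).
Proof.
move=> h1 h2; elim: s => //= j s ->.
by rewrite coord_intD //; exact: iter_int_lip.
Qed.

Lemma iter_intN (s : seq 'I_d) g : coord_lip g ->
  iter_int s (fun x => - g x) = (fun x => - iter_int s g x).
Proof.
move=> h; elim: s => //= j s ->.
by rewrite coord_intN //; exact: iter_int_lip.
Qed.

Lemma iter_int_le (s : seq 'I_d) g (M : R) x : coord_lip g -> (forall x, `|g x| <= M) ->
  `|iter_int s g x| <= (2 * pi) ^+ size s * M.
Proof.
move=> hg hM; elim: s x => [|j s IH] x /=; first by rewrite expr0 mul1r.
by rewrite exprS -mulrA; apply: coord_int_le => //; exact: iter_int_lip.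
Qed.

Lemma iter_int_shift (s : seq 'I_d) j g t : coord_lip g -> coord_periodic g ->
  iter_int s (fun y => g (y + t *: basis_vec R j)) =
  (fun x => iter_int s g (x + t *: basis_vec R j)).
Proof.
move=> hg pg; elim: s => //= i s ->.
by rewrite coord_int_shift //; [exact: iter_int_lip|exact: iter_int_periodic].
Qed.

Lemma iter_int_indep (s : seq 'I_d) j g x t : j \in s ->
  iter_int s g (x + t *: basis_vec R j) = iter_int s g x.
Proof.
elim: s x => //= i s IH x; rewrite inE; have [->|ji] := eqVneq j i => /= js.
  exact: coord_int_indep.
rewrite coord_int_shift_other 1?eq_sym //.
by congr coord_int; apply/funext => y; exact: IH.
Qed.

(** The iterated integral commutes with translations along [e_j], and forgets
    the coordinate [j] of its evaluation point once that coordinate has been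
    integrated out. *)
Lemma torus_int_shift j g t : coord_lip g -> coord_periodic g ->
  torus_int (fun y => g (y + t *: basis_vec R j)) = torus_int g.
Proof.
move=> hg pg; rewrite /torus_int -/(iter_int _ _) iter_int_shift //.
by rewrite iter_int_indep // mem_enum.
Qed.

Lemma torus_int_le g (M : R) : coord_lip g -> (forall x, `|g x| <= M) ->
  `|torus_int g| <= (2 * pi) ^+ d * M.
Proof.
by move=> hg hM; rewrite -{2}(size_enum_ord d); exact: iter_int_le.
Qed.

End CoordinateIntegrals.

(** * Fourier coefficients and half-wavelength translations *)

Section FourierDecay.
Variables (R : realType) (d : nat).
Implicit Types (F V : 'rV[R]_d -> R[i]) (x : 'rV[R]_d) (i j : 'I_d) (k : 'rV[int]_d).

(** The complex counterpart of [coord_lip]. *)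
Definition coord_lipc F : Prop := exists L : R, 0 <= L /\
  forall j x t, cabs (F (x + t *: basis_vec R j) - F x) <= L * `|t|.

Lemma coord_lipc_Re F : coord_lipc F -> coord_lip (fun x => complex.Re (F x)).
Proof.
move=> [L [L0 h]]; exists L; split=> // j x t.
by apply: le_trans (h j x t); rewrite -raddfB; exact: le_Re_cabs.
Qed.

Lemma coord_lipc_Im F : coord_lipc F -> coord_lip (fun x => complex.Im (F x)).
Proof.
move=> [L [L0 h]]; exists L; split=> // j x t.
by apply: le_trans (h j x t); rewrite -raddfB; exact: le_Im_cabs.
Qed.

Lemma torus_cint_shift j F t : coord_lipc F -> torus_fun F ->
  torus_cint (fun y => F (y + t *: basis_vec R j)) = torus_cint F.
Proof.
move=> hF pF; rewrite /torus_cint.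
have pRe : coord_periodic (fun x => complex.Re (F x)) by move=> i x; rewrite (pF i x).
have pIm : coord_periodic (fun x => complex.Im (F x)) by move=> i x; rewrite (pF i x).
by rewrite (torus_int_shift _ _ (coord_lipc_Re hF) pRe)
  (torus_int_shift _ _ (coord_lipc_Im hF) pIm).
Qed.

Lemma coord_lipc_shift v F : coord_lipc F -> coord_lipc (fun y => F (y + v)).
Proof.
move=> [L [L0 h]]; exists L; split=> // j x t.
by rewrite addrAC.
Qed.

Lemma torus_cintD F1 F2 : coord_lipc F1 -> coord_lipc F2 ->
  torus_cint (fun y => F1 y + F2 y) = torus_cint F1 + torus_cint F2.
Proof.
move=> h1 h2; rewrite /torus_cint /torus_int.
have -> : (fun x => complex.Re (F1 x + F2 x)) = fun x => complex.Re (F1 x) + complex.Re (F2 x).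
  by apply/funext => x; rewrite raddfD.
have -> : (fun x => complex.Im (F1 x + F2 x)) = fun x => complex.Im (F1 x) + complex.Im (F2 x).
  by apply/funext => x; rewrite raddfD.
have := iter_intD (enum 'I_d) (coord_lipc_Re h1) (coord_lipc_Re h2); rewrite /iter_int => ->.
by have := iter_intD (enum 'I_d) (coord_lipc_Im h1) (coord_lipc_Im h2); rewrite /iter_int => ->.
Qed.

Lemma torus_cintN F : coord_lipc F ->
  torus_cint (fun y => - F y) = - torus_cint F.
Proof.
move=> h; rewrite /torus_cint /torus_int.
have -> : (fun x => complex.Re (- F x)) = fun x => - complex.Re (F x).
  by apply/funext => x; rewrite raddfN.
have -> : (fun x => complex.Im (- F x)) = fun x => - complex.Im (F x).
  by apply/funext => x; rewrite raddfN.
have := iter_intN (enum 'I_d) (coord_lipc_Re h); rewrite /iter_int => ->.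
by have := iter_intN (enum 'I_d) (coord_lipc_Im h); rewrite /iter_int => ->.
Qed.

Lemma torus_cint_le F (M : R) : coord_lipc F -> (forall x, cabs (F x) <= M) ->
  cabs (torus_cint F) <= 2 * ((2 * pi) ^+ d * M).
Proof.
move=> hF hM; apply: le_trans (cabs_le_ReIm _) _.
rewrite mulr2n mulrDl mul1r; apply: lerD.
- apply: torus_int_le; first exact: coord_lipc_Re.
  by move=> x; exact: le_trans (le_Re_cabs _) (hM x).
- apply: torus_int_le; first exact: coord_lipc_Im.
  by move=> x; exact: le_trans (le_Im_cabs _) (hM x).
Qed.

Lemma cabs_cis (t : R) : cabs (cis t) = 1.
Proof. by rewrite /cabs normc_def /= cos2Dsin2 sqrtr1. Qed.

Lemma cisD (s t : R) : cis (s + t) = cis s * cis t.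
Proof.
by rewrite /cis cosD sinD; apply/eqP; rewrite eq_complex /= [X in _ && (X == _)]addrC !eqxx.
Qed.

Lemma cis_lip (s t : R) : cabs (cis (s + t) - cis s) <= 2 * `|t|.
Proof.
apply: le_trans (cabs_le_ReIm _) _; rewrite mulr2n mulrDl mul1r; apply: lerD => /=.
- rewrite -[leRHS]mulr1; apply: (@mvt_le _ _ (fun z => - sin z)) => z _.
  by rewrite normrN ler_norml sin_geN1 sin_le1.
- rewrite -[leRHS]mulr1; apply: (@mvt_le _ _ cos) => z _.
  by rewrite ler_norml cos_geN1 cos_le1.
Qed.

Lemma dotZ_shift k j x t :
  dotZ k (x + t *: basis_vec R j) = dotZ k x + (k 0 j)%:~R * t.
Proof.
rewrite /dotZ (eq_bigr (fun i => (k 0 i)%:~R * x 0 i + (k 0 i)%:~R * t * (i == j)%:R)).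
  rewrite big_split /=; congr (_ + _).
  rewrite (bigD1 j) //= eqxx mulr1 big1 ?addr0 // => i /negPf ->.
  by rewrite mulr0.
by move=> i _; rewrite /basis_vec !mxE mulrDr mulrA.
Qed.

Definition bounded_cfun F := exists M : R, forall x, cabs (F x) <= M.

Definition wave k : 'rV[R]_d -> R[i] := fun x => cis (- dotZ k x).

Lemma wave_shift k j x t :
  wave k (x + t *: basis_vec R j) = cis (- ((k 0 j)%:~R * t)) * wave k x.
Proof. by rewrite /wave dotZ_shift opprD addrC cisD. Qed.

(** Waves of integer frequency are functions on the torus. *)
Lemma cis_2pi_int (z : int) : cis (- (z%:~R * (2 * pi))) = 1 :> R[i].
Proof.
have h (n : nat) : cis (n%:R * (2 * pi)) = 1 :> R[i].
  elim: n => [|n IH]; first by rewrite mul0r /cis cos0 sin0.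
  by rewrite -addn1 natrD mulrDl mul1r cisD IH mul1r /cis mulr_natl cos2pi sin2pi.
have hN (n : nat) : cis (- (n%:R * (2 * pi))) = 1 :> R[i].
  have := cisD (- (n%:R * (2 * pi))) (n%:R * (2 * pi)); rewrite addNr h mulr1 => <-.
  by rewrite /cis cos0 sin0.
case: z => n; first exact: hN.
by rewrite NegzE mulrNz mulNr opprK; exact: h.
Qed.

Lemma wave_periodic k : torus_fun (wave k).
Proof. by move=> j x; rewrite wave_shift cis_2pi_int mul1r. Qed.

Lemma wave_mul_lipc k V : bounded_cfun V -> coord_lipc V ->
  coord_lipc (fun x => wave k x * V x).
Proof.
move=> [M hM] [L [L0 hL]]; have M0 : 0 <= M := le_trans (cabs_ge0 _) (hM 0).
exists (2 * (normZ k)%:R * M + L); split=> [|j x t].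
  by rewrite addr_ge0 // !mulr_ge0.
set x' := x + _.
have -> : wave k x' * V x' - wave k x * V x =
    (wave k x' - wave k x) * V x' + wave k x * (V x' - V x).
  by rewrite mulrBl mulrBr addrA subrK.
apply: le_trans (cabsD _ _) _; rewrite [leRHS]mulrDl !cabsM cabs_cis mul1r lerD //; last exact: hL.
rewrite /wave dotZ_shift opprD mulrAC.
rewrite ler_pM ?cabs_ge0 //; apply: le_trans (cis_lip _ _) _.
rewrite normrN normrM mulrA ler_wpM2r // ler_wpM2l //.
rewrite -intr_norm -natr_absz ler_nat /normZ (bigD1 j) //=; exact: leq_addr.
Qed.

(** The functions for which Fourier coefficients are computed. Smooth functions on
    the torus qualify, and so do their differences. *)
Record lip_torus V : Prop := LipTorus {
  lip_torus_bounded : bounded_cfun V ;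
  lip_torus_lip : coord_lipc V ;
  lip_torus_periodic : torus_fun V }.

Lemma lip_torus_step_diff p V : lip_torus V -> lip_torus (step_diff p V).
Proof.
move=> [[M hM] [L [L0 hL]] pV]; split.
- by exists (M + M) => x; apply: le_trans (cabsD _ _) _; rewrite cabsN lerD.
- exists (L + L); split=> [|j x t]; first exact: addr_ge0.
  rewrite /step_diff opprD addrACA -opprD mulrDl (addrAC x).
  by apply: le_trans (cabsD _ _) _; rewrite cabsN lerD.
- by move=> j x; rewrite /step_diff (addrAC x) !pV.
Qed.

(** Translating by [pi / k_j], half a wavelength along axis [j], flips the sign of
    the wave: in the coefficient of the difference, the translate of [V] contributes
    as much as [- V]. *)
Lemma fourier_step_diff j k V : k 0 j != 0 -> lip_torus V ->
  fourier (step_diff (j, pi / (k 0 j)%:~R) V) k = - 2 * fourier V k.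
Proof.
move=> kj [bV cV pV]; rewrite /fourier mulrCA; congr (_ * _).
pose h : R := pi / (k 0 j)%:~R.
pose G := fun x => wave k x * V x.
have cG : coord_lipc G by exact: wave_mul_lipc.
have pG : torus_fun G by move=> i x; rewrite /G wave_periodic pV.
have -> : (fun x => cis (- dotZ k x) * step_diff (j, pi / (k 0 j)%:~R) V x) =
    (fun x => - (G (x + h *: basis_vec R j) + G x)).
  apply/funext => x; rewrite /G wave_shift /h [_ * (pi / _)]mulrC divfK ?intr_eq0 //.
  have -> : cis (- pi) = - 1 :> R[i].
    by rewrite /cis cosN sinN cospi sinpi; apply/eqP; rewrite eq_complex /= oppr0 !eqxx.
  by rewrite mulN1r mulNr opprD opprK mulrBr.
have cGh := coord_lipc_shift (h *: basis_vec R j) cG.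
rewrite (torus_cintN (F := fun x => G (x + h *: basis_vec R j) + G x)); last first.
  have [L1 [L10 h1]] := cGh; have [L2 [L20 h2]] := cG.
  exists (L1 + L2); split=> [|i x t]; first exact: addr_ge0.
  by rewrite opprD addrACA mulrDl; apply: le_trans (cabsD _ _) _; rewrite lerD.
rewrite torus_cintD // torus_cint_shift //.
by rewrite -mulr2n mulNr mulr_natl.
Qed.

Lemma fourier_iter_step_diff j k V N : k 0 j != 0 -> lip_torus V ->
  lip_torus (foldr (@step_diff R d) V (nseq N (j, pi / (k 0 j)%:~R))) /\
  fourier (foldr (@step_diff R d) V (nseq N (j, pi / (k 0 j)%:~R))) k =
  (- 2) ^+ N * fourier V k.
Proof.
move=> kj nV; elim: N => [|N [IH1 IH2]] /=; first by rewrite expr0 mul1r.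
split; first exact: lip_torus_step_diff.
by rewrite fourier_step_diff // IH2 exprS mulrA.
Qed.

Lemma fourier_le k V (M : R) : lip_torus V -> (forall x, cabs (V x) <= M) ->
  cabs (fourier V k) <= 2 * M.
Proof.
move=> [bV cV pV] hM; rewrite /fourier cabsM cabs_real.
have tp : 0 < (2 * pi) ^+ d :> R by rewrite exprn_gt0 // mulr_gt0 // pi_gt0.
rewrite ger0_norm ?invr_ge0 ?(ltW tp) // mulrC ler_pdivrMr // -mulrA [M * _]mulrC.
apply: torus_cint_le; first exact: wave_mul_lipc.
by move=> x; rewrite cabsM cabs_cis mul1r.
Qed.

(** The decay in the largest coordinate of [k] is a decay in [k]. *)
Lemma normZ_le_coord k : k != 0 -> exists j, k 0 j != 0 /\ (normZ k <= d * `|k 0%R j|)%N.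
Proof.
move=> k0; have [j0 kj0] : exists j, k 0 j != 0.
  by apply/existsP; apply: contra_neqT k0 => /existsPn h; apply/rowP => j; rewrite mxE; apply/eqP/negPn/h.
pose j := [arg max_(i > j0) `|k 0%R i|%N].
have hj i : (`|k 0%R i| <= `|k 0%R j|)%N.
  by rewrite /j; case: arg_maxnP => // l _; exact.
exists j; split.
  by rewrite -absz_eq0 -lt0n (leq_trans _ (hj j0)) // lt0n absz_eq0.
apply: (@leq_trans (\sum_(i < d) `|k 0%R j|)%N); first by apply: leq_sum => i _.
by rewrite sum_nat_const card_ord.
Qed.

End FourierDecay.

(** * Decay of the Fourier coefficients of smooth functions *)

Section SmoothTorus.
Variables (R : realType) (d : nat).
Implicit Types (F V : 'rV[R]_d -> R[i]) (x : 'rV[R]_d) (i j : 'I_d) (k : 'rV[int]_d).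

Lemma cabs_lip (z w : R[i]) : `|cabs z - cabs w| <= cabs (z - w).
Proof.
rewrite ler_norml; apply/andP; split.
  by rewrite lerNl opprB lerBlDr -{1}(subrK z w) -(cabsN (z - w)) opprB cabsD.
by rewrite lerBlDr -{1}(subrK w z) cabsD.
Qed.

Lemma cabs_continuous : continuous (@cabs R : R[i]^o -> R).
Proof.
move=> z; apply/(@cvgrPdist_lt _ _ _ (nbhs (z : R[i]^o)) _ _ _) => e e0.
have e0' : 0 < e%:C by rewrite ltcR.
near=> w.
have : `|z - w| < e%:C by near: w; exact: cvgr_dist_lt.
by rewrite cabsE ltcR; apply: le_lt_trans; exact: cabs_lip.
Unshelve. all: by end_near. Qed.

Lemma torus_funMz F j (z : int) x : torus_fun F ->
  F (x + (z%:~R * (2 * pi)) *: basis_vec R j) = F x.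
Proof.
move=> pF; have h (n : nat) y : F (y + (n%:R * (2 * pi)) *: basis_vec R j) = F y.
  by rewrite -scalerA scaler_nat (periodicn (pF j)).
case: z => n; first exact: h.
by rewrite NegzE mulrNz mulNr scaleNr -[in LHS](h n.+1) subrK.
Qed.

Lemma torus_fun_sum F (z : 'I_d -> int) s x : torus_fun F ->
  F (x + \sum_(j <- s) ((z j)%:~R * (2 * pi)) *: basis_vec R j) = F x.
Proof.
move=> pF; elim: s x => [|j s IH] x; first by rewrite big_nil addr0.
by rewrite big_cons addrA IH torus_funMz.
Qed.

(** Every point is congruent to one of the compact cube, where the modulus attains
    its maximum. *)
Lemma torus_fun_bounded F : continuous (F : 'rV[R]_d -> R[i]^o) -> torus_fun F ->
  bounded_cfun F.
Proof.
move=> cF pF; pose A := [set v : 'rV[R]_d | forall i, `[0, 2 * pi]%classic (v ord0 i)].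
have tp : 0 < 2 * pi :> R by rewrite mulr_gt0 // pi_gt0.
have A0 : A !=set0.
  by exists 0 => i /=; rewrite mxE in_itv /= lexx ltW.
have cA : compact A.
  by apply: (rV_compact (A := fun=> `[0, 2 * pi]%classic)) => i; exact: segment_compact.
have cf : {within A, continuous (fun x => cabs (F x))}.
  by apply: continuous_subspaceT => x; apply: (@continuous_comp _ R[i]^o R F (@cabs R)); [exact: cF|exact: cabs_continuous].
have [c _ hc] := EVT_max_rV A0 cA cf.
exists (cabs (F c)) => x.
(* subtracting these multiples of 2 pi moves x into the cube *)
pose z i := - Num.floor (x 0 i / (2 * pi)).
rewrite -(torus_fun_sum z (index_enum 'I_d) x pF); apply: hc.
rewrite inE => i /=; rewrite !mxE summxE (bigD1 i) //= big1 ?addr0; last first.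
  by move=> j ji; rewrite /basis_vec !mxE /= eq_sym (negPf ji) mulr0.
rewrite /basis_vec !mxE !eqxx mulr1 /z mulrNz mulNr in_itv /=.
have /andP[h1 h2] := real_floor_itv (num_real (x 0 i / (2 * pi))).
apply/andP; split; first by rewrite subr_ge0 -ler_pdivlMr.
by rewrite lerBlDr -[X in _ <= X + _]mul1r -mulrDl -ler_pdivrMr // ltW // addrC -intrD1.
Qed.

Lemma torus_fun_pderiv j V : torus_fun V -> torus_fun (pderiv j V).
Proof.
move=> pV i x; rewrite /pderiv.
have h (g : 'rV[R]_d -> R) :
    (fun y => g (y + (2 * pi) *: basis_vec R i)) = g ->
    'D_(basis_vec R j) g (x + (2 * pi) *: basis_vec R i) = 'D_(basis_vec R j) g x.
  move=> hg; have := derive_shift g ((2 * pi) *: basis_vec R i) x (basis_vec R j).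
  by rewrite hg.
rewrite (h (fun y => complex.Re (V y))); last by apply/funext => y; rewrite pV.
by rewrite (h (fun y => complex.Im (V y))) //; apply/funext => y; rewrite pV.
Qed.

Lemma torus_fun_foldr s V : torus_fun V -> torus_fun (foldr (@pderiv R d) V s).
Proof. by move=> pV; elim: s => //= j s; exact: torus_fun_pderiv. Qed.

Lemma smooth_torus_bounded s V : torus_fun V -> smooth V ->
  bounded_cfun (foldr (@pderiv R d) V s).
Proof.
move=> pV sV; apply: torus_fun_bounded; first by have [] := sV s.
exact: torus_fun_foldr.
Qed.

Lemma smooth_torus_bounded_all (S : 'I_d -> seq 'I_d) V : torus_fun V -> smooth V ->
  exists M : R, 0 <= M /\ forall j x, cabs (foldr (@pderiv R d) V (S j) x) <= M.
Proof.
move=> pV sV; have /choice[M hM] := fun j => smooth_torus_bounded (S j) pV sV.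
exists (\sum_j `|M j|); split=> [|j x]; first exact: sumr_ge0.
rewrite (le_trans (hM j x)) // (le_trans (ler_norm _)) // (bigD1 j) //= lerDl.
exact: sumr_ge0.
Qed.

Lemma smooth_lip_torus V : torus_fun V -> smooth V -> lip_torus V.
Proof.
move=> pV sV; split => //; first exact: (smooth_torus_bounded [::]).
have [M [M0 hM]] := smooth_torus_bounded_all (fun j => [:: j]) pV sV.
exists (2 * M); split=> [|j x t]; first exact: mulr_ge0.
rewrite mulrAC; apply: mvt_step; first by have [_ ] := sV [::]; exact.
by move=> y _; exact: hM.
Qed.

(** For [k != 0], the N-th difference of [V] with step [pi / k_j] multiplies the
    coefficient by [(-2)^N] while having size [O(|k_j|^-N)]; the axis [j] is the one
    along which [k] is largest. The coefficient at 0 is just bounded. *)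
Lemma fourier_decay V N : torus_fun V -> smooth V ->
  exists C : R, 0 <= C /\ forall k, cabs (fourier V k) <= C * bracket R k ^- N.
Proof.
move=> pV sV; have nV := smooth_lip_torus pV sV.
have [M0 hM0] := lip_torus_bounded nV.
have M00 : 0 <= M0 := le_trans (cabs_ge0 _) (hM0 0).
(* a bound on the pure derivatives of order N, uniform in the axis *)
have [M1 [M10 hM1]] := smooth_torus_bounded_all (fun j => nseq N j) pV sV.
pose C1 := 2 * (pi * (1 + d%:R)) ^+ N * M1.
have pi0 : 0 <= pi :> R := pi_ge0 R.
have C10 : 0 <= C1 by rewrite !mulr_ge0 // exprn_ge0 // mulr_ge0 // addr_ge0.
exists (2 * M0 + C1); split=> [|k]; first by rewrite addr_ge0 // mulr_ge0.
have b0 := bracket_gt0 R k.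
rewrite ler_pdivlMr ?exprn_gt0 //.
have [->|k0] := eqVneq k 0.
  rewrite /bracket normZ0 addr0 expr1n mulr1 (le_trans (fourier_le 0 nV hM0)) //.
  by rewrite lerDl.
have [j [kj hj]] := normZ_le_coord k0.
have kj1 : 1 <= `|(k 0 j)%:~R| :> R.
  by rewrite -intr_norm -natr_absz ler1n absz_gt0.
have kj0 : 0 < `|(k 0 j)%:~R| :> R := lt_le_trans ltr01 kj1.
have bk : bracket R k <= (1 + d%:R) * `|(k 0 j)%:~R|.
  rewrite /bracket mulrDl mul1r lerD // -intr_norm -natr_absz -natrM ler_nat //.
have [nW fW] := fourier_iter_step_diff N kj nV.
set w := nseq N _ in nW fW.
have hW x : cabs (foldr (@step_diff R d) V w x) <= (2 * (pi / `|(k 0 j)%:~R|)) ^+ N * M1.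
  have -> : (2 * (pi / `|(k 0 j)%:~R|)) ^+ N = \prod_(p <- w) (2 * `|p.2|).
    by rewrite big_nseq /= normrM normfV (ger0_norm pi0) iter_mulr_1.
  apply: foldr_step_diff_le; first exact: smooth_pd.
  by move=> y _; rewrite map_nseq; exact: hM1.
have := fourier_le k nW hW.
rewrite fW cabsM cabsX cabsN cabs_nat exprMn -!mulrA mulrCA ler_pM2l ?exprn_gt0 // => h.
apply: (@le_trans _ _ C1); last by rewrite lerDr mulr_ge0.
apply: le_trans (ler_wpM2r (exprn_ge0 N (ltW b0)) h) _.
rewrite /C1 -[leRHS]mulrA -[leLHS]mulrA ler_wpM2l // [leLHS]mulrAC ler_wpM2r //.
rewrite -exprMn; apply: lerXn2r.
- by rewrite nnegrE mulr_ge0 ?(ltW b0) // divr_ge0 // ltW.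
- by rewrite nnegrE mulr_ge0 // addr_ge0.
- by rewrite mulrAC ler_pdivrMr // -mulrA ler_wpM2l.
Qed.

End SmoothTorus.

(** * Summability over the lattice *)

Lemma ler_sum_subseq (R : numDomainType) (I : eqType) (s1 s2 : seq I) (F : I -> R) :
  (forall i, 0 <= F i) -> uniq s1 -> {subset s1 <= s2} ->
  \sum_(i <- s1) F i <= \sum_(i <- s2) F i.
Proof.
move=> F0; elim: s1 s2 => [|x s1 IH] s2 /=; first by rewrite big_nil sumr_ge0.
move=> /andP[xs1 us1] sub; have xs2 := sub x (mem_head _ _).
rewrite big_cons [leRHS](big_rem x) //=.
rewrite lerD2l; apply: IH => // y ys1.
have := sub y; rewrite inE ys1 orbT => /(_ isT).
rewrite (perm_mem (perm_to_rem xs2)) inE => /orP[/eqP yx|//].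
by rewrite -yx ys1 in xs1.
Qed.

Section LatticeSum.
Variables (R : realType) (d : nat).

(** The partial sums stay below [2 - 2 / (1 + K)], because of
    [1 / (1 + n)^2 <= 2 / ((1 + n) * (2 + n))] and telescoping. *)
Lemma sum_inv_square_le2 (K : nat) : \sum_(n < K) (1 + n%:R) ^- 2 <= 2 :> R.
Proof.
apply: (@le_trans _ _ (2 - 2 / (1 + K%:R))); last first.
  by rewrite gerBl divr_ge0 // addr_ge0.
elim: K => [|K IH]; first by rewrite big_ord0 addr0 divr1 subrr.
rewrite big_ord_recr /=; apply: le_trans (lerD IH (lexx _)) _.
have k0 : 0 <= K%:R :> R by [].
rewrite -[K.+1]addn1 natrD; set k : R := K%:R in k0 *.
have h1 : 0 < 1 + k by lra.
have h2 : 0 < 1 + (k + 1) by lra.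
rewrite -subr_ge0.
have -> : 2 - 2 / (1 + (k + 1)) - (2 - 2 / (1 + k) + (1 + k) ^- 2) =
    k / ((1 + k) ^+ 2 * (1 + (k + 1))).
  by field; rewrite !lt0r_neq0.
by rewrite divr_ge0 // mulr_ge0 // ?sqr_ge0 // ltW.
Qed.

(** Integers of absolute value less than [K] are coded by a sign and an ordinal, so
    that boxes of the lattice are images of finite types of functions. *)
Let decode (K : nat) (p : bool * 'I_K) : int := if p.1 then Negz p.2 else Posz p.2.

Let decode_surj K (z : int) : (`|z| < K)%N -> exists p : bool * 'I_K, decode p = z.
Proof.
case: z => n /= hn; first by exists (false, Ordinal hn).
by exists (true, Ordinal (ltnW hn)).
Qed.

Let sum_decode K : \sum_(p : bool * 'I_K) (1 + `|decode p|%N%:R) ^- 2 <= 4 :> R.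
Proof.
apply: (@le_trans _ _ (\sum_(p : bool * 'I_K) (1 + p.2%:R) ^- 2)).
  apply: ler_sum => -[b n] _ /=.
  rewrite lef_pV2 ?posrE ?exprn_gt0 // ?ltr_pwDl //.
  rewrite lerXn2r ?nnegrE ?addr_ge0 // lerD2l ler_nat /decode.
  by case: b.
rewrite -(pair_bigA _ (fun b (n : 'I_K) => (1 + n%:R) ^- 2)) /= big_bool /=.
have := sum_inv_square_le2 K; lra.
Qed.

(** The bound does not depend on the finite set: [A] is contained in a box, over
    which the product of the one-dimensional weights sums to a product. *)
Lemma lattice_sum_le (A : seq 'rV[int]_d) : uniq A ->
  \sum_(k <- A) bracket R k ^- (2 * d) <= 4 ^+ d.
Proof.
move=> uA; pose w (z : int) : R := (1 + `|z|%N%:R) ^- 2.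
have w0 z : 0 <= w z by rewrite invr_ge0 exprn_ge0 // addr_ge0.
have le_w (k : 'rV[int]_d) : bracket R k ^- (2 * d) <= \prod_j w (k 0 j).
  have -> : bracket R k ^- (2 * d) = \prod_(j < d) bracket R k ^- 2.
    by rewrite prodr_const card_ord exprVn -exprM.
  apply: ler_prod => j _; rewrite invr_ge0 exprn_ge0 ?(ltW (bracket_gt0 _ _)) //=.
  rewrite lef_pV2 ?posrE ?exprn_gt0 ?bracket_gt0 // ?ltr_pwDl //.
  rewrite lerXn2r ?nnegrE ?addr_ge0 ?(ltW (bracket_gt0 _ _)) // lerD2l ler_nat.
  by rewrite /normZ (bigD1 j) //= leq_addr.
apply: le_trans (ler_sum _ (fun k _ => le_w k)) _.
pose K := (\max_(k <- A) normZ k).+1.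
pose row (f : {ffun 'I_d -> bool * 'I_K}) : 'rV[int]_d := \row_j decode (f j).
apply: (@le_trans _ _ (\sum_(k <- [seq row f | f : {ffun 'I_d -> bool * 'I_K}])
    \prod_j w (k 0 j))).
  apply: ler_sum_subseq => // [k|k kA]; first exact: prodr_ge0.
  have hK j : exists p : bool * 'I_K, decode p = k 0 j.
    apply: decode_surj; rewrite ltnS.
    have kK : (normZ k <= \max_(l <- A) normZ l)%N by exact: leq_bigmax_seq.
    apply: leq_trans kK.
    by rewrite /normZ (bigD1 j) //= leq_addr.
  have /fin_all_exists[f hf] := hK.
  apply/mapP; exists [ffun j => f j]; first by rewrite mem_enum.
  by apply/rowP => j; rewrite mxE ffunE hf.
rewrite big_image /=.
rewrite (eq_bigr (fun f : {ffun 'I_d -> bool * 'I_K} => \prod_j w (decode (f j)))); last first.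
  by move=> f _; apply: eq_bigr => j _; rewrite mxE.
rewrite -(bigA_distr_bigA (fun (j : 'I_d) p => w (decode p))) /=.
rewrite prodr_const card_ord lerXn2r ?nnegrE ?sumr_ge0 //.
exact: sum_decode.
Qed.

Lemma lattice_sum_shift_le (n : 'rV[int]_d) (A : seq 'rV[int]_d) : uniq A ->
  \sum_(k <- A) bracket R (k - n) ^- (2 * d) <= 4 ^+ d.
Proof.
move=> uA; rewrite -(big_map (fun k => k - n) xpredT (fun k => bracket R k ^- (2 * d))).
by apply: lattice_sum_le; rewrite map_inj_uniq //; exact: addIr.
Qed.

End LatticeSum.

(** * Unordered sums *)

Section UnorderedSums.
Variables (R : realType) (I : choiceType).
Implicit Types (f g : I -> R[i]) (A B : {fset I}).

(** Sums over a finite set seen as a sequence, for which the big operator lemmas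
    are available. *)
Definition psum (K : zmodType) (f : I -> K) A : K := \sum_(i <- A) f i.

Lemma partial_sumE (K : zmodType) (f : I -> K) A : summability.partial_sum f A = psum f A.
Proof. by rewrite /psum big_seq_fsetE. Qed.

(** Convergence along finite sets with real tolerances: [has_sum_cvg] and
    [has_sum_sum] relate it to limits in [R[i]], and everything else is elementary
    from this form. *)
Definition has_sum f (s : R[i]) : Prop := forall e : R, 0 < e ->
  exists A, forall B, (A `<=` B)%fset -> cabs (s - psum f B) < e.

Lemma has_sum_cvg f s : has_sum f s ->
  summability.partial_sum (f : I -> R[i]^o) @ summability.totally --> (s : R[i]^o).
Proof.
move=> hs; apply/(@cvgrPdist_lt _ R[i]^o _ summability.totally
  (summability.totally_filter) _ _) => e e0.
have eE : e = (complex.Re e)%:C by rewrite RRe_real // gtr0_real.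
have e0' : 0 < complex.Re e by rewrite -ltcR -eE.
have [A hA] := hs _ e0'; exists A => // B /= AB.
by rewrite partial_sumE cabsE eE ltcR; exact: hA.
Qed.

Lemma has_sum_sum f s : has_sum f s -> @summability.sum _ _ R[i]^o f = s.
Proof.
move=> /has_sum_cvg hs.
exact: (@cvg_lim _ (@norm_hausdorff _ R[i]^o) _ _ (@summability.totally_filter I) _ _ hs).
Qed.

Lemma has_sumD f g s t : has_sum f s -> has_sum g t ->
  has_sum (fun i => f i + g i) (s + t).
Proof.
move=> hs ht e e0; have e2 : 0 < e / 2 by rewrite divr_gt0.
have [A hA] := hs _ e2; have [B hB] := ht _ e2.
exists (A `|` B)%fset => C; rewrite fsubUset => /andP[/hA hAC /hB hBC].
rewrite /psum big_split /= opprD addrACA (le_lt_trans (cabsD _ _)) //.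
by rewrite [e]splitr ltrD.
Qed.

Lemma has_sumN f s : has_sum f s -> has_sum (fun i => - f i) (- s).
Proof.
move=> hs e e0; have [A hA] := hs _ e0; exists A => B /hA.
by rewrite /psum sumrN -opprD cabsN.
Qed.

Lemma has_sum_eq f g s : f =1 g -> has_sum f s -> has_sum g s.
Proof. by move=> /funext ->. Qed.

Lemma has_sum_reindex f s (tau tau' : I -> I) : cancel tau tau' -> cancel tau' tau ->
  has_sum f s -> has_sum (f \o tau) s.
Proof.
move=> tK t'K hs e e0; have [A hA] := hs _ e0.
exists (tau' @` A)%fset => B AB.
have -> : psum (f \o tau) B = psum f (tau @` B)%fset.
  rewrite /psum big_imfset //= => x y _ _; exact: (can_inj tK).
apply: hA; apply/fsubsetP => x xA; apply/imfsetP; exists (tau' x); last by rewrite t'K.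
by move/fsubsetP : AB; apply; apply/imfsetP; exists x.
Qed.

Lemma has_sum_finite f (i0 : I) : (forall i, i != i0 -> f i = 0) -> has_sum f (f i0).
Proof.
move=> hf e e0; exists [fset i0]%fset => B; rewrite fsub1set => iB.
rewrite /psum (big_fsetD1 i0) //= big_seq big1 ?addr0 ?subrr ?cabs0 // => i.
by rewrite !inE => /andP[/hf].
Qed.

Lemma has_sum_le f s (M : R) : has_sum f s -> (forall A, cabs (psum f A) <= M) ->
  cabs s <= M.
Proof.
move=> hs hM; apply/ler_addgt0Pr => e e0.
have [A hA] := hs _ e0; rewrite -(subrK (psum f A) s) (le_trans (cabsD _ _)) //.
by rewrite addrC lerD // ltW // hA.
Qed.

(** The sum is the supremum of the partial sums. *)
Let has_sum_nneg (g : I -> R) (M : R) : (forall i, 0 <= g i) ->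
  (forall A, psum g A <= M) ->
  exists s : R, forall e, 0 < e -> exists A, forall B, (A `<=` B)%fset ->
    `|s - psum g B| < e.
Proof.
move=> g0 gM; pose E := range (psum g).
have supE : has_sup E.
  by split; [exists (psum g fset0), fset0|exists M => _ [A _ <-]].
exists (sup E) => e e0; have [_ [A _ <-] hA] := sup_adherent e0 supE.
exists A => B AB.
have hB : psum g B <= sup E by apply: sup_upper_bound => //; exists B.
rewrite ger0_norm ?subr_ge0 // ltrBlDr -ltrBlDl (lt_le_trans hA) //.
by apply: ler_sum_subseq => //; exact/fsubsetP.
Qed.

(** [f = (f + g) - g] is a difference of nonnegative families. *)
Let has_sum_real (f g : I -> R) (M : R) : (forall i, `|f i| <= g i) ->
  (forall A, psum g A <= M) ->
  exists s : R, forall e, 0 < e -> exists A, forall B, (A `<=` B)%fset ->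
    `|s - psum f B| < e.
Proof.
move=> fg gM; have g0 i : 0 <= g i := le_trans (normr_ge0 _) (fg i).
have fg0 i : 0 <= f i + g i.
  by have := fg i; rewrite ler_norml => /andP[h _]; rewrite -lerBlDr sub0r.
have fgM A : psum (fun i => f i + g i) A <= M + M.
  rewrite /psum big_split /= lerD ?(gM A) //; apply: le_trans (gM A).
  by apply: ler_sum => i _; exact: le_trans (ler_norm _) (fg i).
have [s hs] := has_sum_nneg fg0 fgM.
have [t ht] := has_sum_nneg g0 gM.
exists (s - t) => e e0; have e2 : 0 < e / 2 by rewrite divr_gt0.
have [A hA] := hs _ e2; have [B hB] := ht _ e2.
exists (A `|` B)%fset => C; rewrite fsubUset => /andP[/hA hAC /hB hBC].
have -> : s - t - psum f C = (s - psum (fun i => f i + g i) C) - (t - psum g C).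
  by rewrite /psum big_split /=; ring.
by rewrite (le_lt_trans (ler_normB _ _)) // [e]splitr ltrD.
Qed.

Lemma has_sum_dominated f (g : I -> R) (M : R) : (forall i, cabs (f i) <= g i) ->
  (forall A, psum g A <= M) -> exists2 s, has_sum f s & cabs s <= M.
Proof.
move=> fg gM.
have [a ha] := has_sum_real (fun i => le_trans (le_Re_cabs (f i)) (fg i)) gM.
have [b hb] := has_sum_real (fun i => le_trans (le_Im_cabs (f i)) (fg i)) gM.
have hs : has_sum f (a +i* b).
  move=> e e0; have e2 : 0 < e / 2 by rewrite divr_gt0.
  have [A hA] := ha _ e2; have [B hB] := hb _ e2.
  exists (A `|` B)%fset => C; rewrite fsubUset => /andP[/hA hAC /hB hBC].
  have Re_psum : complex.Re (psum f C) = psum (fun i => complex.Re (f i)) C.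
    by rewrite /psum; elim/big_rec2: _ => //= i x y _ <-; rewrite raddfD.
  have Im_psum : complex.Im (psum f C) = psum (fun i => complex.Im (f i)) C.
    by rewrite /psum; elim/big_rec2: _ => //= i x y _ <-; rewrite raddfD.
  rewrite (le_lt_trans (cabs_le_ReIm _)) // [e]splitr !raddfB /= Re_psum Im_psum.
  exact: ltrD.
exists (a +i* b) => //; apply: has_sum_le hs _ => A.
apply: le_trans (gM A); rewrite /psum.
elim/big_rec2: _ => [|i x y _ h]; first by rewrite cabs0.
by rewrite (le_trans (cabsD _ _)) // lerD.
Qed.

End UnorderedSums.

(** * The matrix classes *)

Section MatrixClass.
Variables (R : realType) (d : nat).
Implicit Types (A B : imatrix R d) (m n k v : 'rV[int]_d) (a : 'I_d * bool)
  (w : seq ('I_d * bool)).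

Definition mdiff w A : imatrix R d := foldr (fun a => shift_diff (sgn_vec a)) A w.

(** The estimate defining [in_class] for one matrix, with no difference taken. *)
Definition bounded_at_order (r : R) A : Prop := forall N : nat, exists C : R, 0 <= C /\
  forall m n, cabs (A m n) <= C * bracket2 R m n `^ r * bracket R (m - n) ^- N.

(** Differences are taken along arbitrary words of unit steps, in any order and with
    mixed signs, rather than along multi-indices: a difference of a matrix of the
    class is then in a class by definition, which makes the induction on the number
    of differences immediate. *)
Definition word_class (r : R) A : Prop := forall w, bounded_at_order (r - (size w)%:R) (mdiff w A).

Lemma mdiff_rcons w a A : mdiff (rcons w a) A = mdiff w (shift_diff (sgn_vec a) A).
Proof. by rewrite /mdiff foldr_rcons. Qed.

Lemma DeltaE (alpha : 'rV[int]_d) A :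
  Delta alpha A =
  mdiff (flatten [seq nseq `|alpha 0%R j|%N (j, alpha 0 j < 0) | j <- enum 'I_d]) A.
Proof.
rewrite /Delta /mdiff; elim: (enum 'I_d) => //= j s ->; rewrite foldr_cat /Delta1.
set X := foldr _ _ _; case: ltP => [aj|aj]; rewrite ?(lt_geF aj) ?aj.
- elim: `|_|%N => //= l ->; congr (shift_diff _ _).
  by rewrite /sgn_vec /= expr1 scaleN1r.
- elim: `|_|%N => //= l ->; congr (shift_diff _ _).
  by rewrite /sgn_vec /= expr0 scale1r.
Qed.

Lemma word_class_in_class r A : word_class r A -> in_class r A.
Proof.
move=> hA alpha N; rewrite DeltaE; set w := flatten _.
have -> : normZ alpha = size w.
  rewrite size_flatten /shape -map_comp sumnE big_map big_enum /=.
  by apply: eq_bigr => j _; rewrite /= size_nseq.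
have [C [C0 hC]] := hA w N; exists C; split => // m n.
by rewrite cabs_leE; exact: hC.
Qed.

Lemma bounded_at_order_le (r s : R) A : r <= s -> bounded_at_order r A -> bounded_at_order s A.
Proof.
move=> rs hA N; have [C [C0 hC]] := hA N; exists C; split=> // m n.
apply: le_trans (hC m n) _; rewrite ler_wpM2r //.
  by rewrite invr_ge0 exprn_ge0 // ltW // bracket_gt0.
by rewrite ler_wpM2l // ler_powR // bracket2_ge1.
Qed.

Lemma bounded_at_orderD r A B : bounded_at_order r A -> bounded_at_order r B ->
  bounded_at_order r (fun m n => A m n + B m n).
Proof.
move=> hA hB N; have [C [C0 hC]] := hA N; have [C' [C0' hC']] := hB N.
exists (C + C'); split=> [|m n]; first exact: addr_ge0.
by rewrite (le_trans (cabsD _ _)) // !mulrDl lerD.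
Qed.

Lemma mdiffD w A B :
  mdiff w (fun m n => A m n + B m n) = (fun m n => mdiff w A m n + mdiff w B m n).
Proof.
elim: w => //= a w ->; apply/funext => m; apply/funext => n.
by rewrite /shift_diff opprD addrACA.
Qed.

Lemma word_class_order r A : word_class r A -> bounded_at_order r A.
Proof. by move=> /(_ [::]); rewrite subr0. Qed.

Lemma word_class_diff r a A : word_class r A -> word_class (r - 1) (shift_diff (sgn_vec a) A).
Proof.
move=> hA w; have := hA (rcons w a).
by rewrite mdiff_rcons size_rcons -addn1 natrD opprD addrA addrAC.
Qed.

(** Peetre's inequality trades each of the two weights for [bracket2 m n] at the
    price of powers of [bracket (m - k)] and [bracket (k - n)], which the rapid
    off-diagonal decay pays for; enough decay in [k - n] is left to sum over [k]. *)
Lemma imx_mul_bound (r s : R) A B N : bounded_at_order r A -> bounded_at_order s B ->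
  exists K : R, 0 <= K /\ forall m n k, cabs (A m k * B k n) <=
    K * bracket2 R m n `^ (r + s) * bracket R (m - n) ^- N * bracket R (k - n) ^- (2 * d).
Proof.
move=> hA hB.
have [Nr hNr] := bracket_powR_nat d `|r|; have [Ns hNs] := bracket_powR_nat d `|s|.
have [C1 [C10 hC1]] := hA (N + Ns)%N.
have [C2 [C20 hC2]] := hB (N + Nr + 2 * d)%N.
exists (C1 * C2); split=> [|m n k]; first exact: mulr_ge0.
have bmk := bracket_gt0 R (m - k); have bkn := bracket_gt0 R (k - n).
have bmn := bracket_gt0 R (m - n).
have p1 : 0 <= bracket2 R m n `^ r by exact: powR_ge0.
have p2 : 0 <= bracket2 R m n `^ s by exact: powR_ge0.
have hr : bracket2 R m k `^ r <= bracket R (k - n) ^+ Nr * bracket2 R m n `^ r.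
  by apply: le_trans (bracket2_powR r m n k) _; rewrite ler_wpM2r.
have hs : bracket2 R k n `^ s <= bracket R (m - k) ^+ Ns * bracket2 R m n `^ s.
  rewrite (bracket2C _ k) (bracket2C _ m n).
  apply: le_trans (bracket2_powR s n m k) _; rewrite ler_wpM2r ?powR_ge0 //.
  by rewrite -opprB bracketN.
have q1 : 0 <= bracket R (m - k) ^- (N + Ns) by rewrite invr_ge0 exprn_ge0 // ltW.
have q2 : 0 <= bracket R (k - n) ^- (N + Nr + 2 * d) by rewrite invr_ge0 exprn_ge0 // ltW.
have a1 : cabs (A m k) <= C1 * (bracket R (k - n) ^+ Nr * bracket2 R m n `^ r) *
    bracket R (m - k) ^- (N + Ns).
  by apply: le_trans (hC1 m k) _; rewrite ler_wpM2r // ler_wpM2l.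
have a2 : cabs (B k n) <= C2 * (bracket R (m - k) ^+ Ns * bracket2 R m n `^ s) *
    bracket R (k - n) ^- (N + Nr + 2 * d).
  by apply: le_trans (hC2 k n) _; rewrite ler_wpM2r // ler_wpM2l.
rewrite cabsM; apply: le_trans (ler_pM (cabs_ge0 _) (cabs_ge0 _) a1 a2) _.
have split_mn : (bracket R (m - k) * bracket R (k - n)) ^- N <= bracket R (m - n) ^- N.
  rewrite lef_pV2 ?posrE ?exprn_gt0 ?mulr_gt0 // lerXn2r ?nnegrE ?(ltW bmn) //.
    by rewrite mulr_ge0 // ltW.
  by have := bracketD R (m - k) (k - n); rewrite addrA subrK.
rewrite powRD; last by rewrite (gt_eqF (bracket2_gt0 _ _ _)) implybT.
apply: (@le_trans _ _ (C1 * C2 * (bracket2 R m n `^ r * bracket2 R m n `^ s) *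
  (bracket R (m - k) * bracket R (k - n)) ^- N * bracket R (k - n) ^- (2 * d))).
  rewrite le_eqVlt; apply/orP; left; apply/eqP.
  rewrite exprMn !exprD; field; rewrite !expf_neq0 ?gt_eqF //.
rewrite ler_wpM2r ?invr_ge0 ?exprn_ge0 ?(ltW bkn) //.
by rewrite ler_wpM2l // !mulr_ge0.
Qed.

Lemma imx_mul_has_sum (r s : R) A B m n : bounded_at_order r A -> bounded_at_order s B ->
  has_sum (fun k => A m k * B k n) (imx_mul A B m n).
Proof.
move=> hA hB; have [K [K0 hK]] := imx_mul_bound 0 hA hB.
pose c := K * bracket2 R m n `^ (r + s) * bracket R (m - n) ^- 0.
have hp F : psum (fun k => c * bracket R (k - n) ^- (2 * d)) F <= c * 4 ^+ d.
  rewrite /psum -mulr_sumr ler_wpM2l ?lattice_sum_shift_le ?fset_uniq //.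
  by rewrite /c expr0 invr1 mulr1 mulr_ge0 ?powR_ge0.
have [t ht _] := has_sum_dominated (hK m n) hp.
by rewrite (_ : imx_mul A B m n = t) //; exact: has_sum_sum.
Qed.

Lemma imx_mul_order (r s : R) A B : bounded_at_order r A -> bounded_at_order s B ->
  bounded_at_order (r + s) (imx_mul A B).
Proof.
move=> hA hB N; have [K [K0 hK]] := imx_mul_bound N hA hB.
exists (K * 4 ^+ d); split=> [|m n]; first by rewrite mulr_ge0 // exprn_ge0.
apply: has_sum_le (imx_mul_has_sum m n hA hB) _ => F.
have c0 : 0 <= K * bracket2 R m n `^ (r + s) * bracket R (m - n) ^- N.
  by rewrite !mulr_ge0 ?powR_ge0 // invr_ge0 exprn_ge0 // ltW // bracket_gt0.
apply: le_trans (_ : \sum_(k <- F) cabs (A m k * B k n) <= _).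
  rewrite /psum; elim/big_rec2: _ => [|i x y _ h]; first by rewrite cabs0.
  by rewrite (le_trans (cabsD _ _)) // lerD.
apply: le_trans (ler_sum _ (fun k _ => hK m n k)) _.
rewrite -mulr_sumr.
apply: le_trans (ler_wpM2l c0 (lattice_sum_shift_le R n (fset_uniq F))) _.
by rewrite (mulrAC K (4 ^+ d)) (mulrAC (K * _) (4 ^+ d)).
Qed.

(** The diagonal shift reindexes the sum over [k], so the difference of a product
    obeys a Leibniz rule with a second order remainder. *)
Lemma shift_diff_mul (r s : R) a A B : word_class r A -> word_class s B ->
  shift_diff (sgn_vec a) (imx_mul A B) = (fun m n =>
    imx_mul (shift_diff (sgn_vec a) A) B m n +
    (imx_mul (shift_diff (sgn_vec a) A) (shift_diff (sgn_vec a) B) m n +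
     imx_mul A (shift_diff (sgn_vec a) B) m n)).
Proof.
move=> cA cB; set v := sgn_vec a.
have hA := word_class_order cA; have hB := word_class_order cB.
have hA' := word_class_order (word_class_diff a cA).
have hB' := word_class_order (word_class_diff a cB).
apply/funext => m; apply/funext => n.
have s1 := imx_mul_has_sum (m + v) (n + v) hA hB.
have s2 := has_sum_reindex (addrK v) (subrK v) s1.
have s3 := has_sumD s2 (has_sumN (imx_mul_has_sum m n hA hB)).
have t1 := has_sumD (imx_mul_has_sum m n hA' hB)
  (has_sumD (imx_mul_has_sum m n hA' hB') (imx_mul_has_sum m n hA hB')).
rewrite -[RHS](has_sum_sum t1); apply/esym/has_sum_sum.
apply: (has_sum_eq _ s3) => k /=.
rewrite -/v /shift_diff; set x := A (m + v) _; set y := B _ (n + v).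
by rewrite !mulrBl !mulrBr; ring.
Qed.

(** By the Leibniz rule, one difference turns a product of order [r + s] into three
    products of orders [r + s - 1], [r + s - 2] and [r + s - 1], to which the
    induction hypothesis applies. *)
Lemma mdiff_mul_order w (r s : R) A B : word_class r A -> word_class s B ->
  bounded_at_order (r + s - (size w)%:R) (mdiff w (imx_mul A B)).
Proof.
elim/last_ind: w r s A B => [|w a IH] r s A B cA cB.
  by rewrite subr0; apply: imx_mul_order; exact: word_class_order.
have cA' := word_class_diff a cA; have cB' := word_class_diff a cB.
rewrite mdiff_rcons (shift_diff_mul a cA cB) mdiffD mdiffD size_rcons.
have E : (size w).+1%:R = 1 + (size w)%:R :> R by rewrite -natr1 addrC.
apply: bounded_at_orderD; first by apply: bounded_at_order_le (IH _ _ _ _ cA' cB); rewrite E; lra.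
apply: bounded_at_orderD; first by apply: bounded_at_order_le (IH _ _ _ _ cA' cB'); rewrite E; lra.
by apply: bounded_at_order_le (IH _ _ _ _ cA cB'); rewrite E; lra.
Qed.

Lemma word_class_mul (r s : R) A B : word_class r A -> word_class s B ->
  word_class (r + s) (imx_mul A B).
Proof. by move=> cA cB w; exact: mdiff_mul_order. Qed.

Lemma imx_mul_cvg_class (r s : R) A B : word_class r A -> word_class s B ->
  imx_mul_cvg A B.
Proof.
move=> /word_class_order hA /word_class_order hB m n.
apply/cvg_ex; exists (imx_mul A B m n).
exact: has_sum_cvg (imx_mul_has_sum m n hA hB).
Qed.

(** The identity matrix is invariant under diagonal shifts, so that only the empty
    word contributes. *)
Lemma word_class1 : word_class 0 (@imx1 R d).
Proof.
have diff1 a : shift_diff (sgn_vec a) (@imx1 R d) = (fun _ _ => 0).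
  apply/funext => m; apply/funext => n.
  by rewrite /shift_diff /imx1 (inj_eq (@addIr _ _)) subrr.
have diff0 w : mdiff w (fun _ _ => 0) = (fun _ _ => 0).
  elim: w => //= a w ->; apply/funext => m; apply/funext => n.
  by rewrite /shift_diff subrr.
have nn (r : R) N m n : 0 <= 1 * bracket2 R m n `^ r * bracket R (m - n) ^- N.
  by rewrite mul1r mulr_ge0 ?powR_ge0 // invr_ge0 exprn_ge0 // ltW // bracket_gt0.
case/lastP => [|w a] N; exists 1; split=> // m n.
- rewrite /mdiff /= subr0 powRr0 !mul1r /imx1.
  have [->|_] := eqVneq m n; last first.
    by rewrite cabs0 invr_ge0 exprn_ge0 // ltW // bracket_gt0.
  by rewrite cabs1 subrr /bracket normZ0 addr0 expr1n invr1.
- by rewrite mdiff_rcons diff1 diff0 cabs0 nn.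
Qed.

End MatrixClass.

Section MultiplierMatrices.
Variables (R : realType) (d : nat).
Implicit Types (Phi V : 'rV[R]_d -> R[i]).

(** Only the term [k = m] is nonzero. *)
Lemma diag_conv_has_sum Phi V (m n : 'rV[int]_d) :
  has_sum (fun k => diag_imx Phi m k * conv_imx V k n)
    (Phi (map_mx intr m) * fourier V (m - n)).
Proof.
have -> : Phi (map_mx intr m) * fourier V (m - n) = diag_imx Phi m m * conv_imx V m n.
  by rewrite /diag_imx eqxx mulr1.
apply: (has_sum_finite (f := fun k => diag_imx Phi m k * conv_imx V k n)) => k km.
by rewrite /diag_imx eq_sym (negPf km) mulr0 mul0r.
Qed.

Lemma diag_convE Phi V : imx_mul (diag_imx Phi) (conv_imx V) =
  fun m n => Phi (map_mx intr m) * fourier V (m - n).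
Proof.
apply/funext => m; apply/funext => n; exact: has_sum_sum (diag_conv_has_sum Phi V m n).
Qed.

Lemma diag_conv_cvg Phi V : imx_mul_cvg (diag_imx Phi) (conv_imx V).
Proof.
move=> m n; apply/cvg_ex; exists (Phi (map_mx intr m) * fourier V (m - n)).
exact: has_sum_cvg (diag_conv_has_sum Phi V m n).
Qed.

Lemma mdiff_diag_conv w Phi V : mdiff w (imx_mul (diag_imx Phi) (conv_imx V)) =
  fun m n => foldr (@step_diff R d) Phi (map (@sgn_step R d) w) (map_mx intr m) *
    fourier V (m - n).
Proof.
rewrite diag_convE; elim: w => //= a w ->.
apply/funext => m; apply/funext => n; rewrite /shift_diff /step_diff.
by rewrite map_mxD map_sgn_vec opprD addrACA subrr addr0 mulrBl.
Qed.

(** The symbol provides the order and the Fourier coefficients the off-diagonal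
    decay, of which [Ns] powers pay for the change of weight from [bracket m] to
    [bracket2 m n]. *)
Lemma word_class_diag_conv (r : R) Phi V : smooth Phi -> symbol_bounds r Phi ->
  torus_fun V -> smooth V -> word_class r (imx_mul (diag_imx Phi) (conv_imx V)).
Proof.
move=> sPhi hPhi pV sV w N; rewrite mdiff_diag_conv; set s := r - _.
have [C1 [C10 hC1]] := symbol_step_diff w (smooth_pd sPhi) hPhi.
have [Ns hNs] := bracket_powR_nat d `|s|.
have [C2 [C20 hC2]] := fourier_decay (N + Ns) pV sV.
exists (C1 * 2 `^ `|s| * C2); split=> [|m n]; first by rewrite !mulr_ge0 ?powR_ge0.
have b0 := bracket_gt0 R (m - n).
rewrite cabsM; apply: le_trans (ler_pM (cabs_ge0 _) (cabs_ge0 _) (hC1 m) (hC2 _)) _.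
have h : bracket R m `^ s <= 2 `^ `|s| * bracket R (m - n) ^+ Ns * bracket2 R m n `^ s.
  apply: le_trans (bracket_powR_le s m n) _.
  by rewrite ler_wpM2r ?powR_ge0 // ler_wpM2l ?powR_ge0.
apply: (@le_trans _ _ (C1 * (2 `^ `|s| * bracket R (m - n) ^+ Ns * bracket2 R m n `^ s) *
    (C2 * bracket R (m - n) ^- (N + Ns)))).
  rewrite ler_wpM2r ?mulr_ge0 ?invr_ge0 ?exprn_ge0 ?(ltW b0) //.
  by rewrite ler_wpM2l.
rewrite le_eqVlt; apply/orP; left; apply/eqP.
rewrite exprD; field; rewrite !expf_neq0 ?gt_eqF //.
Qed.

End MultiplierMatrices.

Theorem corollary2p8 (R : realType) (d : nat) (hd : (1 <= d)%N)
  (P : nat) (hP : (1 <= P)%N)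
  (r : 'I_P -> R)
  (Phi : 'I_P -> 'rV[R]_d -> R[i])
  (hPhi : forall i, smooth (Phi i))
  (hsym : forall i, symbol_bounds (r i) (Phi i))
  (V : 'I_P -> 'rV[R]_d -> R[i])
  (hVper : forall i, torus_fun (V i))
  (hV : forall i, smooth (V i)) :
  let M := fun i => imx_mul (diag_imx (Phi i)) (conv_imx (V i)) in
  [/\ forall i, imx_mul_cvg (diag_imx (Phi i)) (conv_imx (V i)),
      imx_prod_cvg M
    & in_class (\sum_(i < P) r i) (imx_prod M)].
Proof.
move=> M.
have cM i : word_class (r i) (M i) by exact: word_class_diag_conv.
(* partial products, over any set of indices, for the convergence of each series *)
have cprod (Q : pred 'I_P) : word_class (\sum_(i < P | Q i) r i)
    (\big[@imx_mul R d/@imx1 R d]_(i < P | Q i) M i).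
  elim/big_ind2: _ => [|s A t B cA cB|i _]; [exact: word_class1|exact: word_class_mul|exact: cM].
split=> [i|i|]; first exact: diag_conv_cvg.
- exact: imx_mul_cvg_class (cM i) (cprod _).
- exact/word_class_in_class/cprod.
Qed.
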